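(* The problem of deciding whether an instance of gGASP with $|A^*|=p$ whose underlying social network $(N,L)$ is acyclic has a Nash stable feasible assignment is in FPT with respect to $p$.
   Context: An instance of the group activity selection problem with graph structure (gGASP) consists of: a finite set of players $N=\{1,\dots,n\}$; a finite set of activities $A=A^*\cup\{a_\emptyset\}$, where $A^*=\{a_1,\dots,a_p\}$ is the set of $p$ non-void activities and $a_\emptyset\notin A^*$ is the void activity; for each player $i$ a complete and transitive preference relation $\succeq_i$ on the set of alternatives $(A^*\times\{1,\dots,n\})\cup\{(a_\emptyset,1)\}$, with strict part $\succ_i$; and a set $L$ of edges making $(N,L)$ an undirected graph (the social network). Two alternatives can be compared under $\succeq_i$ in unit time. A graph is acyclic if it is a forest. An assignment is a map $\pi:N\to A$. For $a\in A^*$ let $\pi^a=\{i\in N:\pi(i)=a\}$; let $\pi_i=\{j\in N:\pi(j)=\pi(i)\}$ if $\pi(i)\ne a_\emptyset$, and $\pi_i=\{i\}$ if $\pi(i)=a_\emptyset$. A coalition $S\subseteq N$ is feasible if it is connected in $(N,L)$; $\pi$ is feasible if $\pi_i$ is feasible for every $i\in N$. $\pi$ is individually rational if $(\pi(i),|\pi_i|)\succeq_i(a_\emptyset,1)$ for every $i\in N$. Given a feasible assignment $\pi$, player $i$ has a feasible NS-deviation to $a\in A^*$ with $a\neq\pi(i)$ if $\pi^a\cup\{i\}$ is connected in $(N,L)$ and $(a,|\pi^a|+1)\succ_i(\pi(i),|\pi_i|)$. A feasible assignment is Nash stable if it is individually rational and no player has a feasible NS-deviation. A problem is in FPT with respect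 to a parameter $k$ if each instance $I$ can be solved in time $f(k)\cdot\mathrm{poly}(|I|)$ for some computable function $f$. *)

(* Defs.v *)
From mathcomp Require Import all_boot all_algebra.

Set Implicit Arguments.
Unset Strict Implicit.
Unset Printing Implicit Defensive.

(* Time is measured on unit-cost random access machines, programmed in a while
   language whose store consists of scalar variables and unbounded arrays of
   natural numbers.  The only arithmetic primitives are addition and truncated
   subtraction: with unit-cost multiplication the model would no longer be
   polynomially related to Turing machines.  The five-argument primitive
   [Query] is answered by an external relation in one step. *)

Inductive expr :=
| Num of nat
| Var of nat
| Get of nat & expr
| Add of expr & expr
| Sub of expr & expr
| Query of expr & expr & expr & expr & expr.

(* [Assign x e] is x := e, and [Put a e1 e2] is a[e1] := e2.  Guards hold when
   they are nonzero. *)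
Inductive cmd :=
| Skip
| Assign of nat & expr
| Put of nat & expr & expr
| Seq of cmd & cmd
| If of expr & cmd & cmd
| While of expr & cmd.

Definition oracle := nat -> nat -> nat -> nat -> nat -> bool.

Record store := Store { vars : nat -> nat; arrs : nat -> nat -> nat }.

Definition upd (T : Type) (f : nat -> T) (x : nat) (v : T) : nat -> T :=
  fun y => if y == x then v else f y.

Fixpoint eval (o : oracle) (s : store) (e : expr) : nat :=
  match e with
  | Num c => c
  | Var x => vars s x
  | Get a e1 => arrs s a (eval o s e1)
  | Add e1 e2 => eval o s e1 + eval o s e2
  | Sub e1 e2 => eval o s e1 - eval o s e2
  | Query e1 e2 e3 e4 e5 =>
      o (eval o s e1) (eval o s e2) (eval o s e3) (eval o s e4) (eval o s e5)
  end.

Fixpoint ecost (e : expr) : nat :=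
  match e with
  | Num _ | Var _ => 1
  | Get _ e1 => (ecost e1).+1
  | Add e1 e2 | Sub e1 e2 => (ecost e1 + ecost e2).+1
  | Query e1 e2 e3 e4 e5 =>
      (ecost e1 + ecost e2 + ecost e3 + ecost e4 + ecost e5).+1
  end.

(* [exec o c s t s']: started in store s, c halts in store s' after t steps. *)
Inductive exec (o : oracle) : cmd -> store -> nat -> store -> Prop :=
| ExecSkip s : exec o Skip s 1 s
| ExecAssign x e s :
    exec o (Assign x e) s (ecost e).+1
      (Store (upd (vars s) x (eval o s e)) (arrs s))
| ExecPut a e1 e2 s :
    exec o (Put a e1 e2) s (ecost e1 + ecost e2).+1
      (Store (vars s)
         (upd (arrs s) a (upd (arrs s a) (eval o s e1) (eval o s e2))))
| ExecSeq c1 c2 s s1 s2 t1 t2 :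
    exec o c1 s t1 s1 -> exec o c2 s1 t2 s2 ->
    exec o (Seq c1 c2) s (t1 + t2) s2
| ExecIfTrue e c1 c2 s s' t :
    eval o s e != 0 -> exec o c1 s t s' ->
    exec o (If e c1 c2) s ((ecost e).+1 + t) s'
| ExecIfFalse e c1 c2 s s' t :
    eval o s e = 0 -> exec o c2 s t s' ->
    exec o (If e c1 c2) s ((ecost e).+1 + t) s'
| ExecWhileTrue e c s s1 s2 t1 t2 :
    eval o s e != 0 -> exec o c s t1 s1 -> exec o (While e c) s1 t2 s2 ->
    exec o (While e c) s ((ecost e).+1 + t1 + t2) s2
| ExecWhileFalse e c s :
    eval o s e = 0 -> exec o (While e c) s (ecost e).+1 s.

(* The input is in array 0, the output in variable 0; the rest of the store is
   initially zero. *)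
Definition init (w : seq nat) : store :=
  Store (fun _ => 0) (fun a j => if a == 0 then nth 0 w j else 0).

Definition halts_with (o : oracle) (c : cmd) (w : seq nat) (t v : nat) : Prop :=
  exists2 s, exec o c (init w) t s & vars s 0 = v.

Definition computable (f : nat -> nat) : Prop :=
  exists c : cmd, forall k : nat,
    exists t, halts_with (fun _ _ _ _ _ => false) c [:: k] t (f k).

(* Fixed-parameter tractability of deciding [yes] on the instances in [dom].
   An instance is presented as a word of numbers, whose length is the size
   |I| of the instance, together with an oracle. *)
Definition FPT (T : Type) (dom : T -> Prop) (encode : T -> seq nat)
    (orc : T -> oracle) (param : T -> nat) (yes : T -> bool) : Prop :=
  exists (c : cmd) (f : nat -> nat) (q : {poly nat}),
    computable f /\
    forall I : T, dom I ->
      exists2 t : nat,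
        halts_with (orc I) c (encode I) t (yes I) &
        t <= f (param I) * (q.[size (encode I)])%R.

(* [Some a] is a non-void activity, [None] is the void activity. *)
Definition activity (p : nat) := option 'I_p.

Definition alternative (n p : nat) : {pred activity p * nat} :=
  [pred x | if x.1 is Some _ then 1 <= x.2 <= n else x.2 == 1].
Arguments alternative : clear implicits.

(* The values of [pref i] outside of [alternative n p] are irrelevant. *)
Record gGASP := GGASP {
  nplayers : nat;
  nacts : nat;
  pref : 'I_nplayers -> rel (activity nacts * nat);
  net : rel 'I_nplayers;
  pref_total : forall i, {in alternative nplayers nacts &, total (pref i)};
  pref_trans :
    forall i, {in alternative nplayers nacts & &, transitive (pref i)};
  net_sym : symmetric net;
  net_irr : irreflexive net
}.

Definition acyclic (G : gGASP) : Prop :=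
  forall s : seq 'I_(nplayers G), ucycle (@net G) s -> size s < 3.

Section Stability.

Variable G : gGASP.
Local Notation player := 'I_(nplayers G).
Local Notation assignment := {ffun player -> activity (nacts G)}.

Definition strict_pref (i : player) : rel (activity (nacts G) * nat) :=
  [rel x y | pref i x y && ~~ pref i y x].

Definition connected (S : {set player}) : bool :=
  [forall i in S, forall j in S,
     connect [rel x y | [&& x \in S, y \in S & net x y]] i j].

Definition members (pi : assignment) (a : 'I_(nacts G)) : {set player} :=
  [set i | pi i == Some a].

Definition coalition (pi : assignment) (i : player) : {set player} :=
  if pi i is Some a then members pi a else [set i].

Definition feasible (pi : assignment) : bool :=
  [forall i, connected (coalition pi i)].

Definition individually_rational (pi : assignment) : bool :=
  [forall i, pref i (pi i, #|coalition pi i|) (None, 1)].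

Definition NS_deviation (pi : assignment) (i : player) (a : 'I_(nacts G)) :=
  [&& Some a != pi i,
      connected (i |: members pi a) &
      strict_pref i (Some a, #|members pi a|.+1) (pi i, #|coalition pi i|)].

Definition Nash_stable (pi : assignment) : bool :=
  [&& feasible pi,
      individually_rational pi &
      ~~ [exists i, exists a, NS_deviation pi i a]].

Definition has_Nash_stable : bool := [exists pi : assignment, Nash_stable pi].

(* The numbers n and p, followed by the adjacency matrix of the network.  The
   preferences are accessed through [pref_oracle] and do not contribute to the
   length n ^ 2 + 2 of the word; counting their n * (n * p + 1) alternatives
   would only make the time bound weaker. *)
Definition encode_gGASP : seq nat :=
  nplayers G :: nacts G ::
  [seq (net i j : nat) | i <- enum 'I_(nplayers G),
                         j <- enum 'I_(nplayers G)].

Definition act_code (x : activity (nacts G)) : nat :=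
  if x is Some a then a.+1 else 0.

(* Unit-time comparison of alternatives: [pref_oracle i a k b l] tells whether
   player i weakly prefers (a, k) to (b, l).  Players are numbered from 0, the
   void activity is 0 and the other ones are numbered from 1; queries about
   anything that is not a player or an alternative are answered negatively. *)
Definition pref_oracle : oracle := fun i a k b l =>
  [exists j : player, exists x : activity (nacts G),
   exists y : activity (nacts G),
     [&& (j == i :> nat), act_code x == a, act_code y == b,
         (x, k) \in alternative (nplayers G) (nacts G),
         (y, l) \in alternative (nplayers G) (nacts G) &
         pref j (x, k) (y, l)]].

End Stability.

(* Main.v *)
Require Import Defs.
From mathcomp Require Import all_boot all_algebra.
From mathcomp Require Import zify.

(* Fix the set U of activities that are used by at least one player.  Whether
   an assignment with connected coalitions is Nash stable then depends only on
   conditions on single players (individual rationality, deviations to unused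
   activities) and on edges (deviations to an adjacent coalition), once the
   final size of the coalition of each player is known.  The forest is
   dismantled leaf by leaf: every remaining vertex v carries a bag of vertices
   contracted into it, and a table of the tuples (a, k, t, B) such that the bag
   has a locally stable partial assignment giving v the activity a, in a
   coalition that has t members in the bag and k in the end, where B is the
   bitmask of the other activities used in the bag.  Contracting a leaf x into
   its neighbour y combines two tables; as the edge xy is the only one between
   the two bags, coalitions remain connected exactly when no activity is shared
   by the bags, except for that of x and y if it is the same.  Vertices without
   neighbours are contracted into a virtual void player numbered n.  No loop
   makes more than S = 2^p + n + 1 rounds, so that the running time is bounded by
   a polynomial in S, hence by f(p) * q(n). *)

Set Implicit Arguments.
Unset Strict Implicit.
Unset Printing Implicit Defensive.

(** * Bounded loop programs *)

(** Announcing the final size [k] likewise lets the members of a coalition that is still growing be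
    tested at once. Only the activity of [v] needs a size: any other coalition met in the bag is
    closed, as it could only grow through [v], and a bit in [B] is all that must be remembered to
    forbid a second coalition with the same activity. Contracting arbitrary leaves replaces
    recursion over a rooted tree, which the machine language does not offer. The programs are
    written in a fragment where all loops run up to one variable that they never change. Termination
    is then automatic, [run] is a total function to reason about, and the cost depends only on the
    program and on that bound. The price is that loops cannot stop early, so tables are indexed by
    all tuples below S and must hold 0 in the cells that stand for no solution. *)

Inductive lcmd :=
| LSkip
| LAssign of nat & expr
| LPut of nat & expr & expr
| LSeq of lcmd & lcmd
| LIf of expr & lcmd & lcmd
| LFor of nat & lcmd.

Definition setv (s : store) (x v : nat) : store :=
  Store (upd (vars s) x v) (arrs s).

Definition seta (s : store) (a i v : nat) : store :=
  Store (vars s) (upd (arrs s) a (upd (arrs s a) i v)).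

Fixpoint compile (b : nat) (c : lcmd) : cmd :=
  match c with
  | LSkip => Skip
  | LAssign x e => Assign x e
  | LPut a e1 e2 => Put a e1 e2
  | LSeq c1 c2 => Seq (compile b c1) (compile b c2)
  | LIf e c1 c2 => If e (compile b c1) (compile b c2)
  | LFor x c1 =>
      Seq (Assign x (Defs.Num 0))
        (While (Defs.Sub (Var b) (Var x))
           (Seq (compile b c1) (Assign x (Add (Var x) (Defs.Num 1)))))
  end.

(** The final [setv] records the value with which the compiled [While] leaves its counter. Resetting
    [x] to [i] in each round agrees with the compiled counter only if the body does not assign [x],
    and the number of rounds is fixed only if it does not assign [b]; hence the side conditions of
    [compileP]. *)
Fixpoint run (o : oracle) (b : nat) (c : lcmd) (s : store) : store :=
  match c with
  | LSkip => s
  | LAssign x e => setv s x (eval o s e)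
  | LPut a e1 e2 => seta s a (eval o s e1) (eval o s e2)
  | LSeq c1 c2 => run o b c2 (run o b c1 s)
  | LIf e c1 c2 => if eval o s e != 0 then run o b c1 s else run o b c2 s
  | LFor x c1 =>
      setv (iteri (vars s b) (fun i s' => run o b c1 (setv s' x i)) s)
        x (vars s b)
  end.

Fixpoint avars (c : lcmd) : seq nat :=
  match c with
  | LSkip | LPut _ _ _ => [::]
  | LAssign x _ => [:: x]
  | LSeq c1 c2 | LIf _ c1 c2 => avars c1 ++ avars c2
  | LFor x c1 => x :: avars c1
  end.

Fixpoint aarrs (c : lcmd) : seq nat :=
  match c with
  | LSkip | LAssign _ _ => [::]
  | LPut a _ _ => [:: a]
  | LSeq c1 c2 | LIf _ c1 c2 => aarrs c1 ++ aarrs c2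
  | LFor _ c1 => aarrs c1
  end.

Fixpoint loops_ok (c : lcmd) : bool :=
  match c with
  | LSkip | LAssign _ _ | LPut _ _ _ => true
  | LSeq c1 c2 | LIf _ c1 c2 => loops_ok c1 && loops_ok c2
  | LFor x c1 => (x \notin avars c1) && loops_ok c1
  end.

Definition frame (c : lcmd) (s s' : store) : Prop :=
  (forall z, z \notin avars c -> vars s' z = vars s z) /\
  (forall a, a \notin aarrs c -> arrs s' a = arrs s a).

Lemma updE (T : Type) (f : nat -> T) x v y :
  upd f x v y = if y == x then v else f y.
Proof. by []. Qed.

Lemma vars_setv s x v y : vars (setv s x v) y = if y == x then v else vars s y.
Proof. by []. Qed.

Lemma arrs_setv s x v : arrs (setv s x v) = arrs s.
Proof. by []. Qed.

Lemma frame_refl c s : frame c s s.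
Proof. by split. Qed.

Lemma frame_trans c s1 s2 s3 : frame c s1 s2 -> frame c s2 s3 -> frame c s1 s3.
Proof.
move=> [v12 a12] [v23 a23]; split=> z zc; first by rewrite v23 ?v12.
by rewrite a23 ?a12.
Qed.

Lemma frame_setv c s s' x v : x \in avars c -> frame c s s' -> frame c s (setv s' x v).
Proof.
move=> xc [fv fa]; split=> z zc; last exact: fa.
rewrite vars_setv ifN ?fv //.
by apply: contraNneq zc => ->.
Qed.

Lemma frame_sub c c' s s' :
    {subset avars c <= avars c'} -> {subset aarrs c <= aarrs c'} ->
  frame c s s' -> frame c' s s'.
Proof.
move=> sv sa [fv fa]; split=> z zc; [apply: fv | apply: fa].
  by apply: contra zc => /sv.
by apply: contra zc => /sa.
Qed.

Lemma frame_loop x c i s s' s2 :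
    frame (LFor x c) s s' -> frame c (setv s' x i) s2 -> frame (LFor x c) s s2.
Proof.
move=> f' f2; have f1 : frame (LFor x c) s (setv s' x i).
  by apply: frame_setv f'; rewrite inE eqxx.
apply: frame_trans f1 _.
by apply: frame_sub f2 => z zc //=; rewrite inE zc orbT.
Qed.

Lemma iteri_ind (T : Type) (P : nat -> T -> Prop) f x N :
    P 0 x -> (forall i y, i < N -> P i y -> P i.+1 (f i y)) ->
  P N (iteri N f x).
Proof.
move=> P0; elim: N => [//|N IHN] PS /=; apply: (PS) => //.
by apply: IHN => i y iN; apply: (PS); exact: ltnW.
Qed.

Lemma run_frame o b c s : frame c s (run o b c s).
Proof.
elim: c s => [|x e|a e1 e2|c1 IH1 c2 IH2|e c1 IH1 c2 IH2|x c IH] s.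
- exact: frame_refl.
- by apply: frame_setv (frame_refl _ _); rewrite inE.
- by split=> //= z; rewrite inE => za; rewrite updE (negPf za).
- have f1 : frame (LSeq c1 c2) s (run o b c1 s).
    by apply: frame_sub (IH1 s) => z zc /=; rewrite mem_cat zc.
  apply: frame_trans f1 _; apply: frame_sub (IH2 _) => z zc /=;
  by rewrite mem_cat zc orbT.
- rewrite /=; case: ifP => _.
    by apply: frame_sub (IH1 s) => z zc /=; rewrite mem_cat zc.
  by apply: frame_sub (IH2 s) => z zc /=; rewrite mem_cat zc orbT.
- apply: frame_setv; first by rewrite inE eqxx.
  apply: (iteri_ind (P := fun _ s' => frame (LFor x c) s s')).
    exact: frame_refl.
  by move=> i s' _ f'; apply: frame_loop f' (IH _).
Qed.

(** For a loop, 6 pays for the initial assignment (2) and the failing last test (4), and 8 for a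
    successful test (4) and the increment (4). Charging both branches of a conditional avoids a
    maximum. *)
Fixpoint costb (S : nat) (c : lcmd) : nat :=
  match c with
  | LSkip => 1
  | LAssign _ e => (ecost e).+1
  | LPut _ e1 e2 => (ecost e1 + ecost e2).+1
  | LSeq c1 c2 => costb S c1 + costb S c2
  | LIf e c1 c2 => (ecost e).+1 + (costb S c1 + costb S c2)
  | LFor x c1 => 6 + S * (costb S c1 + 8)
  end.

Lemma compileP o b c s :
    loops_ok c -> b \notin avars c ->
  exists2 t, exec o (compile b c) s t (run o b c s) & t <= costb (vars s b) c.
Proof.
elim: c s => [|x e|a e1 e2|c1 IH1 c2 IH2|e c1 IH1 c2 IH2|x c IH] s.
- by exists 1 => //; constructor.
- by eexists; [constructor|].
- by eexists; [constructor|].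
- move=> /= /andP[ok1 ok2]; rewrite mem_cat negb_or => /andP[b1 b2].
  have [t1 e1 le1] := IH1 s ok1 b1.
  have [t2 e2 le2] := IH2 (run o b c1 s) ok2 b2.
  have eqb : vars (run o b c1 s) b = vars s b by apply: (run_frame o b c1 s).1.
  exists (t1 + t2); first exact: ExecSeq e1 e2.
  by rewrite leq_add // -eqb.
- move=> /= /andP[ok1 ok2]; rewrite mem_cat negb_or => /andP[b1 b2].
  have [t1 e1 le1] := IH1 s ok1 b1.
  have [t2 e2 le2] := IH2 s ok2 b2.
  case: eqP => [e0|/eqP e0] /=.
    by eexists; [apply: ExecIfFalse e0 e2|lia].
  by eexists; [apply: ExecIfTrue e0 e1|lia].
- move=> /= /andP[xc okc]; rewrite inE negb_or => /andP[bx bc].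
  set N := vars s b; pose f i s' := run o b c (setv s' x i).
  have frm i : frame (LFor x c) s (iteri i f s).
    apply: (iteri_ind (P := fun _ s' => frame (LFor x c) s s')).
      exact: frame_refl.
    by move=> j s' _ f'; apply: frame_loop f' (run_frame _ _ _ _).
  have bi i : vars (iteri i f s) b = N.
    by rewrite (frm i).1 //= inE negb_or bx.
  (* Induction on the number [k] of rounds left, from the store reached after [i] rounds. *)
  have loop k i : i + k = N -> exists2 t,
      exec o (While (Defs.Sub (Var b) (Var x))
           (Seq (compile b c) (Assign x (Add (Var x) (Defs.Num 1)))))
        (setv (iteri i f s) x i) t (setv (iteri N f s) x N) &
      t <= 4 + k * (costb N c + 8).
    elim: k i => [|k IHk] i.
      rewrite addn0 => ->; exists 4 => //.
      by apply: ExecWhileFalse; rewrite /= !updE eqxx (negPf bx) bi subnn.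
    rewrite addnS => iN.
    have [|t2 e2 le2] := IHk i.+1; first by rewrite addSn.
    have [t1 e1 le1] := IH (setv (iteri i f s) x i) okc bc.
    have xi : vars (iteri i.+1 f s) x = i.
      by rewrite /= /f (run_frame _ _ _ _).1 // vars_setv eqxx.
    exists (4 + (t1 + 4) + t2); last first.
      move: le1; rewrite vars_setv (negPf bx) bi; nia.
    apply: ExecWhileTrue e2.
      by rewrite /= !updE eqxx (negPf bx) bi; lia.
    apply: ExecSeq e1 _.
    have -> : setv (iteri i.+1 f s) x i.+1 = Store
        (upd (vars (iteri i.+1 f s)) x
           (eval o (iteri i.+1 f s) (Add (Var x) (Defs.Num 1))))
        (arrs (iteri i.+1 f s)) by rewrite [eval _ _ _]/= xi addn1.
    exact: ExecAssign.
  have [//|t e le] := loop N 0; exists (2 + t); last by lia.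
  by apply: ExecSeq e; apply: ExecAssign.
Qed.

(** Each loop raises the degree by one. Degrees of subprograms are added, since only existence
    matters; [0 < S] allows exponents to be raised. The 14 in the loop case is 6 + 8 from
    [costb]. *)
Lemma costb_poly c : exists K d, forall S, 0 < S -> costb S c <= K * S ^ d.
Proof.
have mono K d K' d' S : 0 < S -> K <= K' -> d <= d' -> K * S ^ d <= K' * S ^ d'.
  by move=> S0 leK led; rewrite leq_mul ?leq_pexp2l.
elim: c => [|x e|a e1 e2|c1 [K1 [d1 IH1]] c2 [K2 [d2 IH2]]
           |e c1 [K1 [d1 IH1]] c2 [K2 [d2 IH2]]|x c [K [d IH]]] /=.
- by exists 1, 0.
- by exists (ecost e).+1, 0 => S _; rewrite muln1.
- by exists (ecost e1 + ecost e2).+1, 0 => S _; rewrite muln1.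
- exists (K1 + K2), (d1 + d2) => S S0; rewrite mulnDl leq_add //.
    by apply: leq_trans (IH1 S S0) _; rewrite mono ?leq_addr.
  by apply: leq_trans (IH2 S S0) _; rewrite mono ?leq_addl.
- exists ((ecost e).+1 + (K1 + K2)), (d1 + d2) => S S0; rewrite !mulnDl !leq_add //.
  + by rewrite leq_pmulr // expn_gt0 S0.
  + by apply: leq_trans (IH1 S S0) _; rewrite mono ?leq_addr.
  by apply: leq_trans (IH2 S S0) _; rewrite mono ?leq_addl.
- exists (K + 14), d.+1 => S S0; have := IH S S0; rewrite expnS.
  have: 0 < S ^ d by rewrite expn_gt0 S0.
  move: (S ^ d) (costb S c) => P C P0 le.
  have : S * C <= S * (K * P) by rewrite leq_mul.
  have : S * 1 <= S * P by rewrite leq_mul.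
  by nia.
Qed.

Lemma run_for_ind o b x c s (I : nat -> store -> Prop) :
    I 0 s ->
    (forall i s', i < vars s b -> frame (LFor x c) s s' -> I i s' ->
       I i.+1 (run o b c (setv s' x i))) ->
    (forall s' v, I (vars s b) s' -> I (vars s b) (setv s' x v)) ->
  I (vars s b) (run o b (LFor x c) s).
Proof.
move=> I0 IS Ix /=; apply: Ix.
pose P i s' := frame (LFor x c) s s' /\ I i s'.
suff [] : P (vars s b)
   (iteri (vars s b) (fun i s' => run o b c (setv s' x i)) s) by [].
apply: iteri_ind => [|i s' iN [f' I']]; first by split; first exact: frame_refl.
split; last exact: IS.
exact: frame_loop f' (run_frame _ _ _ _).
Qed.

Definition LFors (xs : seq nat) (c : lcmd) : lcmd := foldr LFor c xs.

Lemma avars_LFors xs c : avars (LFors xs c) = xs ++ avars c.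
Proof. by elim: xs => //= x xs ->. Qed.

Definition in_range (b : nat) (xs : seq nat) (s s' : store) : bool :=
  all (fun x => vars s' x < vars s b) xs.

(** For the inner loops the invariant is strengthened by the value of the outer counter, which they
    cannot change; this is how all counters are known to be in range when the body runs. *)
Lemma run_fors_inv o b xs c s (I : store -> Prop) :
    uniq (b :: xs) -> ~~ has [in b :: xs] (avars c) ->
    I s -> (forall s' x v, x \in xs -> I s' -> I (setv s' x v)) ->
    (forall s', frame (LFors xs c) s s' -> in_range b xs s s' ->
       I s' -> I (run o b c s')) ->
  I (run o b (LFors xs c) s).
Proof.
elim: xs s I => [|x xs IH] s I.
  by move=> _ _ Is _ IS; apply: IS => //; exact: frame_refl.
rewrite cons_uniq inE negb_or => /andP[/andP[bx bxs] /= /andP[xxs uxs]].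
move=> disj Is Ix IS.
have xc : x \notin avars c.
  by apply: contra disj => xc; apply/hasP; exists x; rewrite // !inE eqxx orbT.
apply: (run_for_ind (I := fun _ => I)) => //; last first.
  by move=> s' v; apply: Ix; rewrite inE eqxx.
move=> i s' iN f' I'.
pose I2 s2 := I s2 /\ vars s2 x = i.
suff [] : I2 (run o b (LFors xs c) (setv s' x i)) by [].
have bN : vars (setv s' x i) b = vars s b.
  rewrite vars_setv (negPf bx) f'.1 //= avars_LFors inE mem_cat !negb_or bx bxs.
  by apply: contra disj => bc; apply/hasP; exists b; rewrite // !inE eqxx.
apply: IH.
- by rewrite /= bxs.
- apply/hasPn => z zc; have /hasPn/(_ z zc) := disj.
  by rewrite !inE !negb_or => /and3P[-> _ ->].
- by split; [apply: Ix; rewrite // inE eqxx | rewrite vars_setv eqxx].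
- move=> s2 y v ys [I2' xi]; split; first by apply: Ix; rewrite // inE ys orbT.
  by rewrite vars_setv ifN //; apply: contraNneq xxs => ->.
move=> s2 f2 r2 [I2' xi]; split; last by rewrite (run_frame o b c s2).1.
apply: IS => //; first exact: frame_loop f' f2.
by move: r2; rewrite /in_range bN /= xi iN.
Qed.

(* The tuple [vs] of loop values is reached, so what the body does there
   persists to the end. *)
Lemma run_fors_hit o b xs c s (vs : seq nat) (I K : store -> Prop) :
    uniq (b :: xs) -> ~~ has [in b :: xs] (avars c) ->
    size vs = size xs -> all (fun v => v < vars s b) vs ->
    I s -> (forall s' x v, x \in xs -> I s' -> I (setv s' x v)) ->
    (forall s' x v, x \in xs -> K s' -> K (setv s' x v)) ->
    (forall s', frame (LFors xs c) s s' -> in_range b xs s s' ->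
       I s' -> I (run o b c s')) ->
    (forall s', frame (LFors xs c) s s' -> in_range b xs s s' ->
       I s' -> K s' -> K (run o b c s')) ->
    (forall s', frame (LFors xs c) s s' -> I s' -> map (vars s') xs = vs ->
       K (run o b c s')) ->
  K (run o b (LFors xs c) s).
Proof.
elim: xs s vs I => [|x xs IH] s [|v vs] // I.
  by move=> _ _ _ _ Is _ _ _ _; apply=> //; exact: frame_refl.
move=> ubxs disj; move: (ubxs).
rewrite cons_uniq inE negb_or => /andP[/andP[bx bxs] /= /andP[xxs uxs]].
move=> [] szv /andP[vN vsN] Is Ix Kx IS KS hit.
have xc : x \notin avars c.
  by apply: contra disj => xc; apply/hasP; exists x; rewrite // !inE eqxx orbT.
have disj' : ~~ has [in b :: xs] (avars c).
  apply/hasPn => z zc; have /hasPn/(_ z zc) := disj.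
  by rewrite !inE !negb_or => /and3P[-> _ ->].
have bl : b \notin avars (LFors (x :: xs) c).
  rewrite /= avars_LFors inE mem_cat !negb_or bx bxs.
  by apply: contra disj => bc; apply/hasP; exists b; rewrite // !inE eqxx.
(* [K] is claimed only once the outer counter has passed [v]: round [v] establishes it by the
   induction hypothesis, later rounds preserve it. *)
pose J i s' := [/\ frame (LFor x (LFors xs c)) s s', I s' & v < i -> K s'].
suff [_ _]: J (vars s b) (run o b (LFor x (LFors xs c)) s) by apply.
apply: run_for_ind => [|i s' iN f' [_ I' K']|s' w [f' I' K']]; last first.
- split; last by move=> vb; apply: Kx; rewrite ?inE ?eqxx //; apply: K'.
    by apply: frame_setv; rewrite // inE eqxx.
  by apply: Ix; rewrite // inE eqxx.
- pose I2 s2 := I s2 /\ vars s2 x = i.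
  have I20 : I2 (setv s' x i).
    by split; [apply: Ix; rewrite // inE eqxx | rewrite vars_setv eqxx].
  have I2x s2 y w : y \in xs -> I2 s2 -> I2 (setv s2 y w).
    move=> ys [I2' xi]; split; first by apply: Ix; rewrite // inE ys orbT.
    by rewrite vars_setv ifN //; apply: contraNneq xxs => ->.
  have Kxs s2 y w : y \in xs -> K s2 -> K (setv s2 y w).
    by move=> ys; apply: Kx; rewrite inE ys orbT.
  have bN : vars (setv s' x i) b = vars s b.
    by rewrite vars_setv (negPf bx) f'.1.
  have rng s2 : in_range b xs (setv s' x i) s2 -> vars s2 x = i ->
      in_range b (x :: xs) s s2.
    by rewrite /in_range bN /= => r2 xi; rewrite xi iN.
  have I2S s2 : frame (LFors xs c) (setv s' x i) s2 ->
      in_range b xs (setv s' x i) s2 -> I2 s2 -> I2 (run o b c s2).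
    move=> f2 r2 [I2' xi]; split; last by rewrite (run_frame o b c s2).1.
    by apply: IS => //; [exact: frame_loop f' f2 | exact: rng].
  have [I1 _] : I2 (run o b (LFors xs c) (setv s' x i)).
    by apply: run_fors_inv => //; rewrite /= bxs.
  split=> //; first exact: frame_loop f' (run_frame _ _ _ _).
  rewrite ltnS leq_eqVlt => /predU1P[vi|vi]; last first.
    pose IK s2 := I2 s2 /\ K s2.
    suff [//] : IK (run o b (LFors xs c) (setv s' x i)).
    apply: run_fors_inv => [||||s2 f2 r2 [I2' K2]] //.
    + by rewrite /= bxs.
    + by split=> //; apply: Kx; [rewrite inE eqxx | apply: K'].
    + by move=> s2 y w ys [I2' K2]; split; [apply: I2x | apply: Kxs].
    split; first exact: I2S.
    by have [I2i xi] := I2'; apply: KS => //; [exact: frame_loop f' f2 | exact: rng].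
  apply: (IH _ vs I2) => //.
  + by rewrite /= bxs.
  + by rewrite bN.
  + move=> s2 f2 r2 [I2' xi]; apply: KS => //; [exact: frame_loop f' f2|exact: rng].
  + move=> s2 f2 [I2' xi] mvs; apply: hit => //=; first exact: frame_loop f' f2.
    by rewrite mvs xi vi.
- by split=> //; exact: frame_refl.
Qed.

(** * Bitmasks *)

Definition bit (c b : nat) : bool := odd (iter b half c).

Definition bdisj (x y : nat) : Prop := forall b, ~~ (bit x b && bit y b).

Lemma bit0 c : bit c 0 = odd c.
Proof. by []. Qed.

Lemma bitS c b : bit c b.+1 = bit c./2 b.
Proof. by rewrite /bit iterSr. Qed.

Lemma bit_zero b : bit 0 b = false.
Proof. by elim: b => // b IH; rewrite bitS. Qed.

Lemma bdisj_half x y :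
  bdisj x y <-> ~~ (odd x && odd y) /\ bdisj x./2 y./2.
Proof.
split=> [d|[d0 dS] [|b]]; last by rewrite !bitS.
  by split=> [|b]; [exact: (d 0)|rewrite -!bitS].
by rewrite !bit0.
Qed.

Lemma bdisj0 x : bdisj 0 x.
Proof. by move=> b; rewrite bit_zero. Qed.

(** Without a common bit there is no carry. This lets the program form disjoint unions of masks by
    addition. *)
Lemma bit_add x y b : bdisj x y -> bit (x + y) b = bit x b || bit y b.
Proof.
elim: b x y => [|b IH] x y /bdisj_half[o d].
  by rewrite !bit0 oddD; case: (odd x) (odd y) o => [] [].
by rewrite !bitS halfD (negPf o) add0n IH.
Qed.

Lemma bit_inj x y : (forall b, bit x b = bit y b) -> x = y.
Proof.
have [m] := ubnP (x + y); elim: m x y => // m IH x y xym e.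
have [/eqP|xy0] := posnP (x + y); first by rewrite addn_eq0 => /andP[/eqP-> /eqP->].
have := e 0; rewrite !bit0 => eo.
rewrite -[x]odd_double_half -[y]odd_double_half eo (IH x./2 y./2) //; first lia.
by move=> b; rewrite -!bitS.
Qed.

Lemma lt_bit c p : (forall b, bit c b -> b < p) -> c < 2 ^ p.
Proof.
elim: p c => [|p IH] c cp.
  suff -> : c = 0 by [].
  by apply: bit_inj => b; rewrite bit_zero; apply/negP => /cp.
have : c./2 < 2 ^ p by apply: IH => b; rewrite -bitS => /cp.
by rewrite expnS; lia.
Qed.

Lemma bit_exp2 a b : bit (2 ^ a) b = (a == b).
Proof.
elim: a b => [|a IH] [|b]; rewrite ?bitS ?bit0 //.
- by rewrite bit_zero.
- by rewrite expnS mul2n odd_double.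
by rewrite expnS mul2n doubleK IH.
Qed.

Lemma bits_exist (P : pred nat) p :
  (forall b, P b -> b < p) -> exists c, forall b, bit c b = P b.
Proof.
elim: p P => [|p IH] P Pp.
  by exists 0 => b; rewrite bit_zero; apply/esym/negP => /Pp.
have [|c cP] := IH (fun b => P b.+1); first by move=> b /Pp.
exists (P 0 + c.*2) => -[|b]; rewrite ?bit0 ?bitS.
  by rewrite oddD odd_double addbF; case: (P 0).
by rewrite half_bit_double cP.
Qed.

(** * Locally stable partial assignments *)

(** Locates the edge by which a connected coalition leaves a bag, or by which a deviator is attached
    to its new coalition. *)
Lemma connect_cross (T : finType) (r : rel T) (P : pred T) i j :
    connect r i j -> P i -> ~~ P j ->
  exists u v, [/\ r u v, P u & ~~ P v].
Proof.
case/connectP=> q; elim: q i => [|v q IH] i /=; first by move=> _ -> ->.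
case/andP=> riv rq lq Pi Pj; have [Pv|Pv] := boolP (P v); first exact: IH lq Pv Pj.
by exists i, v.
Qed.

Lemma connectedP (G : gGASP) (S : {set 'I_(nplayers G)}) :
  reflect {in S &, forall i j,
    connect [rel x y | [&& x \in S, y \in S & net x y]] i j} (connected S).
Proof.
apply: (iffP forall_inP) => [H i j iS jS|H i iS].
  by have /forall_inP := H i iS; apply.
by apply/forall_inP => j jS; apply: H.
Qed.

Lemma connected0 (G : gGASP) : connected (set0 : {set 'I_(nplayers G)}).
Proof. by apply/connectedP => i j; rewrite inE. Qed.

Lemma connected1 (G : gGASP) (i : 'I_(nplayers G)) : connected [set i].
Proof. by apply/connectedP => u v /set1P-> /set1P->. Qed.

Lemma connect_subset (G : gGASP) (S T : {set 'I_(nplayers G)}) i j :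
    S \subset T ->
    connect [rel x y | [&& x \in S, y \in S & net x y]] i j ->
  connect [rel x y | [&& x \in T, y \in T & net x y]] i j.
Proof.
move=> /subsetP ST; apply: connect_sub => u v /and3P[uS vS uv].
by apply: connect1; rewrite /= !ST.
Qed.

Lemma connectedU (G : gGASP) (S T : {set 'I_(nplayers G)}) x y :
    connected S -> connected T -> x \in S -> y \in T -> net x y ->
  connected (S :|: T).
Proof.
move=> /connectedP cS /connectedP cT xS yT xy; apply/connectedP.
set r := [rel _ _ | _]; have rs : connect_sym r.
  by apply: sym_connect_sym => u v /=; rewrite net_sym andbCA.
have SU i j : i \in S -> j \in S -> connect r i j.
  by move=> iS jS; apply: connect_subset (cS _ _ iS jS); exact: subsetUl.
have TU i j : i \in T -> j \in T -> connect r i j.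
  by move=> iT jT; apply: connect_subset (cT _ _ iT jT); exact: subsetUr.
have rxy : connect r x y by apply: connect1; rewrite /= !inE xS yT xy orbT.
have toy i : i \in S :|: T -> connect r i y.
  by case/setUP => [iS|iT]; [apply: connect_trans (SU _ _ iS xS) rxy|apply: TU].
by move=> i j /toy iy /toy jy; apply: connect_trans iy _; rewrite rs.
Qed.

(* Collapsing the rest of S to x retracts every path of S into S1. *)
Lemma connected_part (G : gGASP) (S S1 : {set 'I_(nplayers G)}) x :
    S1 \subset S -> (forall i j, i \in S1 -> j \in S :\: S1 -> net i j -> i = x) ->
  connected S -> connected S1.
Proof.
move=> /subsetP sub out /connectedP cS; apply/connectedP => i j iS1 jS1.
pose h u := if u \in S1 then u else x.
suff : connect [rel x y | [&& x \in S1, y \in S1 & net x y]] (h i) (h j).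
  by rewrite /h iS1 jS1.
case/connectP: (cS i j (sub _ iS1) (sub _ jS1)) => q; elim: q i {iS1 jS1} => [|v q IH] i /=.
  by move=> _ ->.
case/andP=> /and3P[iS vS iv] rq lq; apply: connect_trans (IH _ rq lq).
rewrite /h; case: ifP => i1; case: ifP => v1.
- by apply: connect1; rewrite /= i1 v1.
- by rewrite (out i v) // inE v1.
- by rewrite (out v i) // ?inE ?i1 // net_sym.
by [].
Qed.

Section PartialAssignments.

Variable G : gGASP.
Local Notation n := (nplayers G).
Local Notation p := (nacts G).
Local Notation player := 'I_(nplayers G).
Local Notation Q := (@pref_oracle G).

(** Used in two ways: positive answers bound the entries of a tuple, and negative answers outside
    the alternatives make [content] hold trivially, as for joining a void neighbour (the void
    activity has size 1 only) or for the virtual player [n]. *)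
Lemma pref_oracle_dom i a k b l :
  Q i a k b l -> [/\ i < n, a <= p, k <= maxn n 1 & a = 0 -> k = 1].
Proof.
case/existsP=> j /existsP[u] /existsP[v].
case/and5P=> /eqP<- /eqP<- _ ualt _; split => //.
- by case: u ualt => // u _; exact: ltn_ord.
- by case: u ualt => [u|] /=; rewrite inE /= => H; lia.
by case: u ualt => [u|] //=; rewrite inE /= => /eqP.
Qed.

(** Activity code [b] occupies bit [b.-1]. The void activity gets the empty mask, so any number of
    void players never clash. *)
Definition wt (b : nat) : nat := if 0 < b <= p then 2 ^ b.-1 else 0.

(* Player i does not prefer activity b with l players to a with k players. *)
Definition content (i b l a k : nat) : bool := ~~ (Q i b l a k && ~~ Q i a k b l).

Definition node_ok (U i a k : nat) : Prop :=
  Q i a k 0 1 /\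
  forall b, 0 < b <= p -> bdisj (wt b) U -> content i b 1 a k.

Definition part (f : player -> nat) (X : {set player}) (b : nat) : {set player} :=
  [set i in X | f i == b].

(* Sizes of the final coalitions: k is the one announced for activity a, whose
   coalition may still grow. *)
Definition csize (f : player -> nat) (X : {set player}) (a k c : nat) : nat :=
  if c == a then k else if c == 0 then 1 else #|part f X c|.

(* f is locally stable on X when U codes the activities used overall; X is
   attached to the rest of the forest by y only, or by nothing if y = n; player
   y has activity a, with t of its final k members in X, and B codes the other
   activities used in X. *)
Record valid (U y : nat) (X : {set player}) (a k t B : nat)
    (f : player -> nat) : Prop := Valid {
  valid_void : a = 0 -> k = 1 /\ t = 1;
  valid_node : forall i, i \in X -> node_ok U i (f i) (csize f X a k (f i));
  valid_edge : forall i j, i \in X -> j \in X -> net i j ->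
    (f i = f j /\ f i <> 0) \/
    content i (f j) (csize f X a k (f j)).+1 (f i) (csize f X a k (f i));
  valid_conn : forall b, b != 0 -> connected (part f X b);
  valid_bits : forall b, bit B b = (b.+1 != a) && [exists i in X, f i == b.+1];
  valid_count : a != 0 -> #|part f X a| = t;
  valid_top : forall i : player, i = y :> nat -> i \in X /\ f i = a;
  valid_root : y = n -> a = 0
}.

Definition sem (U y : nat) (X : {set player}) (a k t B : nat) : Prop :=
  exists f, valid U y X a k t B f.

Lemma bit_wt a b : a <= p -> bit (wt a) b = (a == b.+1).
Proof.
rewrite /wt; case: a => [|a] ap /=; first by rewrite bit_zero.
by rewrite ap bit_exp2 eqSS.
Qed.

Lemma wt_lt a : wt a < 2 ^ p.
Proof.
rewrite /wt; case: ifP => [/andP[a0 ap]|_]; last by rewrite expn_gt0.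
by rewrite ltn_exp2l //; lia.
Qed.

Lemma valid_act U y X a k t B f i :
  valid U y X a k t B f -> i \in X -> f i <= p.
Proof. by move=> v /(valid_node v)[/pref_oracle_dom[]]. Qed.

(** If [a] is not void then [y] is a player, whose own rationality query bounds [a] and [k]; if it
    is void then [k = t = 1]. The bits of [B] come from players of [X], whose activities are at most
    p. *)
Lemma valid_bound U y X a k t B f : y <= n ->
  valid U y X a k t B f -> [/\ a <= p, k <= maxn n 1, t <= maxn n 1 & B < 2 ^ p].
Proof.
move=> yn v; have [a0|a0] := eqVneq a 0.
  have [-> ->] := valid_void v a0; rewrite a0; split=> //; try lia.
  apply: lt_bit => b; rewrite (valid_bits v) => /andP[_ /exists_inP[i iX /eqP]].
  by move=> fi; have := valid_act v iX; rewrite fi.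
have yltn : y < n.
  by rewrite ltn_neqAle yn andbT; apply: contra a0 => /eqP /(valid_root v)->.
have [yX fy] := valid_top v (erefl (nat_of_ord (Ordinal yltn))).
have := valid_node v yX; rewrite fy /csize eqxx => -[/pref_oracle_dom[_ ap kn _] _].
split=> //.
  rewrite -(valid_count v a0) (leq_trans (max_card _)) // card_ord; lia.
apply: lt_bit => b; rewrite (valid_bits v) => /andP[_ /exists_inP[i iX /eqP]].
by move=> fi; have := valid_act v iX; rewrite fi.
Qed.

(** [B] leaves out the activity of [y], whose coalition may still grow. Adding it back gives all
    activities of the bag, since [y] itself witnesses a nonvoid [a]. *)
Lemma used_bits U y X a k t B f b : y <= n -> valid U y X a k t B f ->
  bit (B + wt a) b = [exists i in X, f i == b.+1].
Proof.
move=> yn v; have [ap _ _ _] := valid_bound yn v.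
rewrite bit_add; last first.
  move=> c; rewrite (valid_bits v) bit_wt //.
  by rewrite [a == _]eq_sym; case: eqP => //=; rewrite andbF.
rewrite (valid_bits v) bit_wt // [a == _]eq_sym; case: eqP => //= ab; last by rewrite orbF.
have yltn : y < n.
  by rewrite ltn_neqAle yn andbT; apply/eqP => /(valid_root v); rewrite -ab.
have [yX fy] := valid_top v (erefl (nat_of_ord (Ordinal yltn))).
by apply/esym/existsP; exists (Ordinal yltn); rewrite yX fy ab eqxx.
Qed.

Lemma part_glue (X Y : {set player}) f f1 f2 b :
    (forall i, i \in X -> f i = f1 i) -> (forall i, i \in Y -> f i = f2 i) ->
  part f (X :|: Y) b = part f1 X b :|: part f2 Y b.
Proof.
move=> fX fY; apply/setP => i; rewrite !inE.
have [iX|iX] := boolP (i \in X); have [iY|iY] := boolP (i \in Y) => //=.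
- by rewrite -fX // -fY // orbb.
- by rewrite -fX // orbF.
- by rewrite -fY.
Qed.

Lemma part_eq0 f (X : {set player}) b :
  ~~ [exists i in X, f i == b] -> part f X b = set0.
Proof.
move=> /existsPn H; apply/setP => i; rewrite !inE; apply/negbTE.
exact: H.
Qed.

(** The edge lies inside one coalition, for which both sides announced the same final size. The
    masks already leave out the shared activity, so plain disjointness is the right test. *)
Definition join_ok (a k t B a' k' t' B' t2 B2 : nat) : Prop :=
  [/\ a = a', a <> 0, k = k', t + t' = t2 & bdisj B B' /\ B + B' = B2].

(** The edge separates two coalitions, void players being alone. The coalition of [x] cannot grow
    any more, hence [t = k], and its activity moves into the mask. Disjointness of the full masks
    excludes a common nonvoid activity; the [content] clauses test deviations across the edge in
    both directions. *)
Definition split_ok (x a k t B y a' k' t' B' t2 B2 : nat) : Prop :=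
  [/\ t = k, bdisj (B + wt a) (B' + wt a'), content x a' k'.+1 a k,
      content y a k.+1 a' k' & t' = t2 /\ B + wt a + B' = B2].

(** * Merging two bags along the only edge between them *)

Section Merge.

Variables (U : nat) (x : player) (y : nat) (X Y : {set player}).
Hypothesis yn : y <= n.
Hypothesis XY : [disjoint X & Y].
Hypothesis cross : forall i j, i \in X -> j \in Y -> net i j -> i = x /\ j = y :> nat.
Hypothesis xy : forall j : player, j = y :> nat -> net x j.

Lemma notinXY i : i \in X -> i \in Y = false.
Proof. by move=> iX; apply/negbTE; rewrite (disjointFr XY). Qed.

(** The glued assignment inherits the conditions of both sides once every player is seen to keep its
    final coalition size. Only the edge between [x] and [y] is new, and [join_ok] or [split_ok]
    settles it. *)
Lemma glue_valid a k t B a' k' t' B' t2 B2 :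
    sem U x X a k t B -> sem U y Y a' k' t' B' ->
    join_ok a k t B a' k' t' B' t2 B2 \/
      split_ok x a k t B y a' k' t' B' t2 B2 ->
  sem U y (X :|: Y) a' k' t2 B2.
Proof.
move=> [f1 v1] [f2 v2] ok; have xn : x <= n by apply: ltnW; exact: ltn_ord.
have [xX f1x] := valid_top v1 (erefl (x : nat)).
pose f i := if i \in X then f1 i else f2 i.
have fX i : i \in X -> f i = f1 i by rewrite /f => ->.
have fY i : i \in Y -> f i = f2 i.
  by rewrite /f; case: ifP => // /notinXY ->.
have partE := part_glue _ fX fY.
have yP : a' <> 0 -> exists2 j : player, j = y :> nat & j \in Y /\ f2 j = a'.
  move=> a'0; have yltn : y < n.
    by rewrite ltn_neqAle yn andbT; apply/eqP => /(valid_root v2).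
  by exists (Ordinal yltn) => //; apply: (valid_top v2).
(* Disjointness of the masks leaves only the common activity of [x] and [y] as a nonvoid activity
   present on both sides; under [split_ok] there is none. *)
have sep c i j : c <> 0 -> i \in X -> f1 i = c -> j \in Y -> f2 j = c ->
    [/\ c = a, c = a' & k = k'].
  move=> c0 iX f1i jY f2j.
  have u1 : [exists i in X, f1 i == c.-1.+1].
    by apply/existsP; exists i; rewrite iX f1i; apply/eqP; lia.
  have u2 : [exists i in Y, f2 i == c.-1.+1].
    by apply/existsP; exists j; rewrite jY f2j; apply/eqP; lia.
  case: ok => [[aa' a0 kk' _ [/(_ c.-1) d _]]|[_ /(_ c.-1) d _ _ _]].
    have [ca|ca] := eqVneq c a; first by split; rewrite -?aa'.
    move: d; rewrite (valid_bits v1) (valid_bits v2) u1 u2 -aa' prednK ?ca //.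
    by rewrite lt0n; apply/eqP.
  by move: d; rewrite (used_bits _ xn v1) (used_bits _ yn v2) u1 u2.
have kk' : a = a' -> k = k'.
  move=> aa'; have [a0|a0] := eqVneq a 0.
    by have [-> _] := valid_void v1 a0; have [|-> _] := valid_void v2; rewrite -?aa'.
  have [|j jy [jY f2j]] := yP; first by rewrite -aa'; apply/eqP.
  by have [] := sep a x j (elimN eqP a0) xX f1x jY; rewrite ?aa'.
have tk : a <> a' -> t = k by case: ok => [[]|[]].
(* A nonvoid activity of [X] other than [a'] does not occur in [Y]; if it is [a], its coalition is
   now complete and [tk] identifies the actual count with the announced [k]. *)
have szX i : i \in X -> csize f (X :|: Y) a' k' (f1 i) = csize f1 X a k (f1 i).
  move=> iX; set c := f1 i; rewrite /csize.
  have [c0|/eqP c0] := eqVneq c 0.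
    rewrite c0 [0 == a]eq_sym [0 == a']eq_sym.
    case: eqP => [/(valid_void v2)[-> _]|_]; case: eqP => [/(valid_void v1)[-> _]|_] //.
  have [ca'|/eqP ca'] := eqVneq c a'.
    have [|j jy [jY f2j]] := yP; first by rewrite -ca'.
    by have [|<- _ <-] := sep c i j c0 iX erefl jY; rewrite ?eqxx ?ca'.
  rewrite partE [part f2 Y c]part_eq0 ?setU0.
    case: eqP => // ca; rewrite ca (valid_count v1) ?tk -?ca //; exact/eqP.
  apply/existsP => -[j /andP[jY /eqP f2j]].
  by have [|_ /ca'] := sep c i j c0 iX erefl jY.
have szY i : i \in Y -> csize f (X :|: Y) a' k' (f2 i) = csize f2 Y a' k' (f2 i).
  move=> iY; set c := f2 i; rewrite /csize; case: eqP => // ca'.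
  case: eqP => // c0; rewrite partE [part f1 X c]part_eq0 ?set0U //.
  apply/existsP => -[j /andP[jX /eqP f1j]].
  by have [|_ /ca'] := sep c j i c0 jX f1j iY.
have t2P : a' != 0 -> #|part f (X :|: Y) a'| = t2.
  move=> a'0; rewrite partE cardsU.
  have -> : part f1 X a' :&: part f2 Y a' = set0.
    apply/setP => i; rewrite !inE; case: (boolP (i \in X)) => //= iX.
    by rewrite notinXY // andbF.
  rewrite cards0 subn0 (valid_count v2) //.
  case: ok => [[aa' a0 _ <- _]|[_ /= d _ _ [<- _]]].
    by rewrite -aa' (valid_count v1) //; apply/eqP.
  rewrite [part f1 X a']part_eq0 ?cards0 //; apply/existsP => -[i /andP[iX /eqP f1i]].
  have [|j jy [jY f2j]] := yP; first exact/eqP.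
  have := d a'.-1; rewrite (used_bits _ xn v1) (used_bits _ yn v2).
  have a'P : a'.-1.+1 = a' by rewrite prednK // lt0n.
  rewrite a'P; case/negP; apply/andP; split; apply/existsP.
    by exists i; rewrite iX f1i eqxx.
  by exists j; rewrite jY f2j eqxx.
have bitsP b : bit B2 b = (b.+1 != a') && [exists i in X :|: Y, f i == b.+1].
  have exU : [exists i in X :|: Y, f i == b.+1] =
      [exists i in X, f1 i == b.+1] || [exists i in Y, f2 i == b.+1].
    apply/existsP/orP => [[i /andP[/setUP[] iX]]|[] /existsP[i /andP[iX fi]]].
    - by rewrite fX // => fi; left; apply/existsP; exists i; rewrite iX.
    - by rewrite fY // => fi; right; apply/existsP; exists i; rewrite iX.
    - by exists i; rewrite inE iX fX.
    - by exists i; rewrite inE iX orbT fY.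
  case: ok => [[aa' _ _ _ [d <-]]|[_ d _ _ [_ <-]]].
    by rewrite bit_add // (valid_bits v1) (valid_bits v2) exU aa' andb_orr.
  have [a'p _ _ _] := valid_bound yn v2.
  have dB' : bdisj B' (wt a').
    by move=> c; rewrite (valid_bits v2) bit_wt // [a' == _]eq_sym; case: eqP => //=; rewrite andbF.
  rewrite bit_add; last first.
    by move=> c; have := d c; rewrite (bit_add _ dB') negb_and negb_or negb_and; case: (bit _ c) => //= /andP[].
  rewrite (used_bits _ xn v1) (valid_bits v2) exU; case: eqP => //= ba'; last first.
  rewrite orbF; apply/negbTE/negP => u1; have := d b; rewrite (used_bits _ xn v1) u1.
  by rewrite (bit_add _ dB') bit_wt // -ba' eqxx orbT.
exists f; split=> //.
- by move=> a'0; have [-> t'1] := valid_void v2 a'0; split=> //; case: ok => [[-> /(_ a'0)]|[_ _ _ _ [<- _]]].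
- move=> i /setUP[iX|iY].
    by rewrite fX // szX //; exact: valid_node v1 _ iX.
  by rewrite fY // szY //; exact: valid_node v2 _ iY.
- have crossP i j : i \in X -> j \in Y -> net i j ->
      (f1 i = f2 j /\ f1 i <> 0) \/
      (content i (f2 j) (csize f2 Y a' k' (f2 j)).+1 (f1 i) (csize f1 X a k (f1 i)) /\
       content j (f1 i) (csize f1 X a k (f1 i)).+1 (f2 j) (csize f2 Y a' k' (f2 j))).
    move=> iX jY ij; have [ix jy] := cross iX jY ij; rewrite {}ix in iX ij *.
    have [_ f2j] := valid_top v2 jy; rewrite f1x f2j /csize !eqxx.
    by case: ok => [[]|[_ _ cx cy _]]; [left | right; rewrite jy].
  move=> i j /setUP[iX|iY] /setUP[jX|jY] ij.
  + by rewrite !fX // !szX //; exact: valid_edge v1 _ _ iX jX ij.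
  + rewrite (fX i) // (fY j) // szX // szY //.
    by case: (crossP i j iX jY ij) => [|[]]; [left|right].
  + rewrite (fX j) // (fY i) // szX // szY //; rewrite net_sym in ij.
    by case: (crossP j i jX iY ij) => [[e0 n0]|[]]; [left; rewrite -e0|right].
  + by rewrite !fY // !szY //; exact: valid_edge v2 _ _ iY jY ij.
- move=> b b0; rewrite partE.
  have [/existsP[i /andP[iX /eqP f1i]]|/part_eq0->] := boolP [exists i in X, f1 i == b]; last first.
    by rewrite set0U (valid_conn v2).
  have [/existsP[j /andP[jY /eqP f2j]]|/part_eq0->] := boolP [exists i in Y, f2 i == b]; last first.
    by rewrite setU0 (valid_conn v1).
  have [ba ba' _] := sep b i j (elimN eqP b0) iX f1i jY f2j.
  have [|j' jy [j'Y f2j']] := yP; first by rewrite -ba'; apply/eqP.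
  apply: (@connectedU _ _ _ x j'); rewrite ?inE ?xX ?j'Y ?f1x ?f2j' -?ba -?ba' ?eqxx //.
  + exact: valid_conn v1 _ b0.
  + exact: valid_conn v2 _ b0.
  exact: xy.
- by move=> i iy; have [iY f2i] := valid_top v2 iy; rewrite inE iY orbT fY.
- exact: valid_root v2.
Qed.

(** The same [f] serves both sides. A coalition meeting both bags is connected, hence uses the edge
    between [x] and [y], so its activity is that of both ends. *)
Lemma split_valid a' k' t2 B2 :
    x \in X -> (forall j : player, j = y :> nat -> j \in Y) ->
    sem U y (X :|: Y) a' k' t2 B2 ->
  exists a k t B t' B',
    [/\ sem U x X a k t B, sem U y Y a' k' t' B' &
        join_ok a k t B a' k' t' B' t2 B2 \/
        split_ok x a k t B y a' k' t' B' t2 B2].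
Proof.
move=> xX yY [f v].
have xn : x <= n by apply: ltnW; exact: ltn_ord.
have xXY i : i \in X -> i \in X :|: Y by rewrite inE => ->.
have yXY i : i \in Y -> i \in X :|: Y by rewrite inE orbC => ->.
have partE := part_glue _ (fun i (_ : i \in X) => erefl (f i))
                           (fun i (_ : i \in Y) => erefl (f i)).
have yP : a' <> 0 -> exists2 j : player, j = y :> nat & j \in Y /\ f j = a'.
  move=> a'0; have yltn : y < n.
    by rewrite ltn_neqAle yn andbT; apply/eqP => /(valid_root v).
  exists (Ordinal yltn) => //; split; first exact: yY.
  by have [] := valid_top v (erefl (nat_of_ord (Ordinal yltn))).
have sep c i j : c <> 0 -> i \in X -> f i = c -> j \in Y -> f j = c ->
    c = f x /\ c = a'.
  move=> c0 iX fi jY fj.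
  have /connectedP cc := valid_conn v (introN eqP c0).
  have /= := cc i j; rewrite !inE iX jY fi fj eqxx orbT => /(_ isT isT) cij.
  have [|u [w [/and3P[]]]] := connect_cross (P := mem X) cij iX.
    by rewrite inE; apply/negP => /notinXY; rewrite jY.
  rewrite !inE => /andP[_ /eqP fu] /andP[+ /eqP fw] uw uX wX.
  rewrite (negPf wX) /= => wY; have [ux wy] := cross uX wY uw.
  have [_ fwa] := valid_top v wy.
  by split; [rewrite -ux fu | rewrite -fwa fw].
(* The size announced for [x] is the one in the whole union, while [t] and [t'] count on one side
   only; void players get 1 by convention. *)
set a := f x; pose k := csize f (X :|: Y) a' k' a.
pose t := if a == 0 then 1 else #|part f X a|.
pose t' := if a' == 0 then 1 else #|part f Y a'|.
have bex (Z : {set player}) z : Z \subset X :|: Y -> exists B, forall b,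
    bit B b = (b.+1 != z) && [exists i in Z, f i == b.+1].
  move=> ZXY; apply: (@bits_exist
    (fun b => (b.+1 != z) && [exists i in Z, f i == b.+1]) p) => b /andP[_].
  case/exists_inP => i iZ /eqP fi; rewrite -fi.
  exact: valid_act v (subsetP ZXY _ iZ).
have [B BP] := bex X a (subsetUl _ _); have [B' B'P] := bex Y a' (subsetUr _ _).
have k1 : a = 0 -> k = 1.
  by move=> a0; rewrite /k /csize a0; case: eqP => // /esym/(valid_void v)[].
have partX c : c <> 0 -> c <> a' \/ c <> a -> [exists i in X, f i == c] ->
    part f (X :|: Y) c = part f X c.
  move=> c0 cc /existsP[i /andP[iX /eqP fi]]; rewrite partE [part f Y c]part_eq0 ?setU0 //.
  apply/existsP => -[j /andP[jY /eqP fj]].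
  by have [ca ca'] := sep c i j c0 iX fi jY fj; case: cc.
have partY c : c <> 0 -> c <> a' \/ c <> a -> [exists i in Y, f i == c] ->
    part f (X :|: Y) c = part f Y c.
  move=> c0 cc /existsP[i /andP[iX /eqP fi]]; rewrite partE [part f X c]part_eq0 ?set0U //.
  apply/existsP => -[j /andP[jY /eqP fj]].
  by have [ca ca'] := sep c j i c0 jY fj iX fi; case: cc.
have szX i : i \in X -> csize f X a k (f i) = csize f (X :|: Y) a' k' (f i).
  move=> iX; rewrite {1}/csize; case: eqP => [->//|ca]; rewrite /csize.
  have [c0|/eqP c0] := eqVneq (f i) 0.
    by rewrite c0; case: eqP => // /esym/(valid_void v)[].
  have ca' : f i <> a'.
    move=> ca'; have [|j jy [jY fj]] := yP; first by rewrite -ca'.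
    by have [] := sep (f i) i j c0 iX erefl jY; rewrite ?fj.
  case: eqP => // _; rewrite partX //; first by left.
  by apply/existsP; exists i; rewrite iX eqxx.
have szY i : i \in Y -> csize f Y a' k' (f i) = csize f (X :|: Y) a' k' (f i).
  move=> iY; rewrite /csize; case: eqP => // ca'; case: eqP => // c0.
  rewrite partY //; first by left.
  by apply/existsP; exists i; rewrite iY eqxx.
have connX b : b != 0 -> connected (part f X b).
  move=> b0; apply: (connected_part (x := x)) (valid_conn v b0).
    by apply/subsetP => i; rewrite !inE => /andP[-> ->].
  move=> i j; rewrite !inE => /andP[iX _] /andP[+ /andP[jXY fj]] ij.
  rewrite fj andbT => jX; rewrite (negPf jX) /= in jXY.
  by have [] := cross iX jXY ij.
have connY b : b != 0 -> connected (part f Y b).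
  (* If [y = n], no edge joins the bags, so the default [x] never matters. *)
  move=> b0; pose yy := if insub y is Some j then j else x.
  apply: (connected_part (x := yy)) (valid_conn v b0).
    by apply/subsetP => i; rewrite !inE => /andP[-> ->]; rewrite orbT.
  move=> i j; rewrite !inE => /andP[iY _] /andP[+ /andP[jX fj]] ij.
  rewrite fj andbT => jY; rewrite (negPf jY) orbF in jX; rewrite net_sym in ij.
  have [_ iy] := cross jX iY ij; apply/val_inj => /=; rewrite /yy -iy.
  by rewrite valK.
have vX : valid U x X a k t B f.
  split=> //.
  - by move=> a0; rewrite /t a0 eqxx k1.
  - by move=> i iX; rewrite szX //; apply: valid_node v _ (xXY _ iX).
  - by move=> i j iX jX ij; rewrite !szX //; apply: valid_edge v _ _ (xXY _ iX) (xXY _ jX) ij.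
  - by rewrite /t => /negPf->.
  - by move=> i /val_inj->.
  - by move=> xn'; have := ltn_ord x; rewrite xn' ltnn.
have vY : valid U y Y a' k' t' B' f.
  split=> //.
  - by move=> a'0; rewrite /t' a'0 eqxx; have [] := valid_void v a'0.
  - by move=> i iX; rewrite szY //; apply: valid_node v _ (yXY _ iX).
  - by move=> i j iX jX ij; rewrite !szY //; apply: valid_edge v _ _ (yXY _ iX) (yXY _ jX) ij.
  - by rewrite /t' => /negPf->.
  - by move=> i iy; split; [apply: yY | have [] := valid_top v iy].
  - exact: valid_root v.
exists a, k, t, B, t', B'; split; [by exists f | by exists f |].
have exU b : [exists i in X :|: Y, f i == b] =
      [exists i in X, f i == b] || [exists i in Y, f i == b].
  apply/existsP/orP => [[i /andP[/setUP[] iX fi]]|[] /existsP[i /andP[iX fi]]].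
  - by left; apply/existsP; exists i; rewrite iX.
  - by right; apply/existsP; exists i; rewrite iX.
  - by exists i; rewrite inE iX.
  - by exists i; rewrite inE iX orbT.
have cardU c : #|part f (X :|: Y) c| = #|part f X c| + #|part f Y c|.
  rewrite partE cardsU; have -> : part f X c :&: part f Y c = set0.
    apply/setP => i; rewrite !inE; case: (boolP (i \in X)) => //= iX.
    by rewrite notinXY // andbF.
  by rewrite cards0 subn0.
have [aa'|aa'] := boolP ((a == a') && (a != 0)).
  left; case/andP: aa' => /eqP aa' a0; split=> //; first exact/eqP.
  - by rewrite /k /csize aa' eqxx.
  - by rewrite /t /t' -aa' (negPf a0) -cardU aa' (valid_count v) // -aa'.
  have d : bdisj B B'.
    move=> b; rewrite BP B'P; apply/negP => /andP[/andP[ba]].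
    case/existsP=> i /andP[iX /eqP fi] /andP[_] /existsP[j /andP[jY /eqP fj]].
    by have [//|bE _] := sep b.+1 i j _ iX fi jY fj; rewrite bE eqxx in ba.
  split=> //; apply: bit_inj => b.
  by rewrite bit_add // BP B'P (valid_bits v) exU aa' andb_orr.
right.
have d : bdisj (B + wt a) (B' + wt a').
  move=> b; rewrite (used_bits _ xn vX) (used_bits _ yn vY); apply/negP => /andP[].
  case/existsP=> i /andP[iX /eqP fi] /existsP[j /andP[jY /eqP fj]].
  have [//|ba ba'] := sep b.+1 i j _ iX fi jY fj.
  by move: aa'; rewrite -/a in ba; rewrite -ba -ba' eqxx.
have tk : t = k.
  rewrite /t; have [a0|a0] := eqVneq a 0; first by rewrite k1.
  have naa' : a <> a' by move=> aE; rewrite -aE eqxx a0 in aa'.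
  rewrite /k /csize (negPf a0); case: eqP => // _; rewrite partX //.
  - exact/eqP.
  - by left.
  by apply/existsP; exists x; rewrite xX eqxx.
(* For [y = n] the oracle rejects both queries: the void activity with 2 players is no alternative,
   and [n] is no player. Otherwise these are the two orientations of [valid_edge]. *)
have cont : content x a' k'.+1 a k /\ content y a k.+1 a' k'.
  have [yltn|] := ltnP y n; last first.
    move=> ny; have yE : y = n by apply/eqP; rewrite eqn_leq yn ny.
    have a'0 := valid_root v yE; have [k'1 _] := valid_void v a'0.
    rewrite /content; split; apply/negP => /andP[/pref_oracle_dom[yltn _ _]].
      by rewrite a'0 k'1 => /(_ erefl).
    by rewrite yE ltnn in yltn.
  pose yy := Ordinal yltn; have nxy : net x yy by apply: xy.
  have yyY : yy \in Y by apply: yY.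
  have [_ fyy] := valid_top v (erefl (yy : nat)).
  have nE : ~ (a = a' /\ a <> 0).
    by move=> -[e0 n0]; case/negP: aa'; rewrite e0 eqxx -e0; apply/eqP.
  have := valid_edge v (xXY _ xX) (yXY _ yyY) nxy.
  have := valid_edge v (yXY _ yyY) (xXY _ xX); rewrite net_sym nxy => /(_ isT).
  rewrite -szX // -szY // fyy -/a /csize !eqxx => -[[e0 n0]|cy] [[e1 n1]|cx] //.
  + by case: nE; rewrite -e0.
  + by case: nE; rewrite -e0.
  + by case: nE; rewrite -e1.
case: cont => cx cy; split=> //; split.
  rewrite /t'; have [a'0|a'0] := eqVneq a' 0; first by have [] := valid_void v a'0.
  rewrite -(valid_count v a'0) cardU [part f X a']part_eq0 ?cards0 //.
  apply/existsP => -[i /andP[iX /eqP fi]]; have [|j jy [jY fj]] := yP; first exact/eqP.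
  have [|aE _] := sep a' i j _ iX fi jY fj; first exact/eqP.
  by move: aa'; rewrite -/a in aE; rewrite -aE eqxx a'0.
have [ap _ _ _] := valid_bound xn vX.
have [a'p _ _ _] := valid_bound yn vY.
have dB' : bdisj B' (wt a').
  by move=> c; rewrite B'P bit_wt // [a' == _]eq_sym; case: eqP => //=; rewrite andbF.
apply: bit_inj => b; rewrite bit_add; last first.
  by move=> c; have := d c; rewrite (bit_add _ dB') negb_and negb_or negb_and; case: (bit _ c) => //= /andP[].
rewrite (used_bits _ xn vX) B'P (valid_bits v) exU; case: eqP => //= ba'.
rewrite orbF; apply/negbTE/negP => u1; have := d b.
by rewrite (used_bits _ xn vX) u1 (bit_add _ dB') bit_wt // -ba' eqxx orbT.
Qed.

End Merge.

End PartialAssignments.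

(** Isolated vertices count as leaves. If every vertex of [A] had two neighbours in [A], there would
    be paths of any length in [A]: when all neighbours of the head lie on the path, one of them is
    not its successor and closes a cycle of at least three vertices. *)
Lemma acyclic_leaf (G : gGASP) (A : {set 'I_(nplayers G)}) :
    acyclic G -> A != set0 ->
  exists2 x, x \in A & forall i j, i \in A -> j \in A ->
    net x i -> net x j -> i = j.
Proof.
move=> acG /set0Pn[x0 x0A].
have [/existsP[x /andP[xA /forall_inP xP]]|/existsPn noleaf] :=
    boolP [exists x in A, [forall i in A, forall j in A,
             net x i ==> net x j ==> (i == j)]].
  exists x => // i j iA jA xi xj; apply/eqP.
  by have /forall_inP/(_ j jA) := xP i iA; rewrite xi xj.
have long m : exists x q, [/\ size q = m, uniq (x :: q), path (@net G) x q &
    all [in A] (x :: q)].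
  elim: m => [|m [x [q [sq uq pq aq]]]]; first by exists x0, [::]; rewrite /= x0A.
  have xA : x \in A by case/andP: aq.
  have [/existsP[z /and3P[zA zx zq]]|/existsPn allin] :=
      boolP [exists z, [&& z \in A, net x z & z \notin x :: q]].
    by exists z, (x :: q); split; rewrite /= ?sq ?zq // ?[net z x]net_sym ?zx ?zA.
  have inq z : z \in A -> net x z -> z \in q.
    move=> zA xz; have := allin z; rewrite zA xz negbK inE => /predU1P[zx|//].
    by rewrite zx net_irr in xz.
  have [i [j [iA jA xi xj ij]]] : exists i j,
      [/\ i \in A, j \in A, net x i, net x j & i != j].
    have := noleaf x; rewrite xA => /forall_inPn[i iA] /forall_inPn[j jA].
    by rewrite !negb_imply => /and3P[xi xj ij]; exists i, j.
  case: q sq uq pq aq inq {allin} => [|y q] sq uq pq aq inq; first by have := inq i iA xi.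
  have [z [zA xz zq]] : exists z, [/\ z \in A, net x z & z \in q].
    have := inq i iA xi; have := inq j jA xj; rewrite !inE.
    have [jy /= _|_ /= jq _] := eqVneq j y; last by exists j.
    by rewrite -jy (negPf ij) /= => iq; exists i.
  case/path.splitP: zq uq pq => q1 q2 uq pq.
  have : ucycle (@net G) (x :: y :: rcons q1 z).
    rewrite /ucycle; apply/andP; split.
      move: pq; rewrite /= cat_path => /and3P[-> pq _].
      by rewrite rcons_path last_rcons [net z x]net_sym xz pq.
    by move: uq; rewrite -!cat_cons cat_uniq => /andP[].
  by move/acG; rewrite /= size_rcons.
have [x [q [sq uq _ _]]] := long #|'I_(nplayers G)|.
by have := card_uniqP uq; have := max_card [in x :: q]; move=> + eq; rewrite eq /= sq ltnn.
Qed.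

(** * Tables of single vertices, and Nash stability as an entry of the root table *)

Section Leaves.

Variable G : gGASP.
Local Notation n := (nplayers G).
Local Notation p := (nacts G).
Local Notation player := 'I_(nplayers G).
Local Notation Q := (@pref_oracle G).
Local Notation wt := (wt G).
Local Notation content := (content G).
Local Notation node_ok := (node_ok G).

Lemma sem_leaf U (x : player) a k t B :
  sem U x [set x] a k t B <-> [/\ node_ok U x a k, t = 1 & B = 0].
Proof.
split=> [[f v]|[ok -> ->]].
  have [xX fx] := valid_top v (erefl (x : nat)).
  split.
  - by have := valid_node v xX; rewrite fx /csize eqxx.
  - have [a0|a0] := eqVneq a 0; first by have [] := valid_void v a0.
    rewrite -(valid_count v a0) -(cards1 x); congr #|pred_of_set _|.
    by apply/setP => i; rewrite !inE; case: eqP => //= ->; rewrite fx eqxx.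
  apply: bit_inj => b; rewrite bit_zero (valid_bits v); apply/negbTE/negP.
  by case/andP=> ba /exists_inP[i /set1P-> /eqP]; rewrite fx => aE; rewrite aE eqxx in ba.
have ex b : [exists i in [set x], a == b.+1] = (b.+1 == a).
  rewrite eq_sym; apply/exists_inP/eqP => [[i _ /eqP]|->] //.
  by exists x; rewrite ?inE ?eqxx.
have [Qx _] := ok; have [_ _ _ k1] := pref_oracle_dom Qx.
exists (fun _ => a); split.
- by move/k1.
- by move=> i /set1P->; rewrite /csize eqxx.
- by move=> i j /set1P-> /set1P->; rewrite net_irr.
- move=> b _; rewrite /part; case: (eqVneq a b) => ab.
    rewrite (_ : [set _ in _ | _] = [set x]) ?connected1 //.
    by apply/setP => i; rewrite !inE andbT.
  rewrite (_ : [set _ in _ | _] = set0) ?connected0 //.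
  by apply/setP => i; rewrite !inE andbF.
- by move=> b; rewrite bit_zero ex andNb.
- move=> _; rewrite -(cards1 x); congr #|pred_of_set _|.
  by apply/setP => i; rewrite !inE eqxx andbT.
- by move=> i /val_inj->; rewrite inE eqxx.
by move=> xn; have := ltn_ord x; rewrite xn ltnn.
Qed.

Lemma sem_root U a k t B :
  sem U n (set0 : {set player}) a k t B <-> [/\ a = 0, k = 1, t = 1 & B = 0].
Proof.
split=> [[f v]|[-> -> -> ->]].
  have a0 := valid_root v (erefl _); have [-> ->] := valid_void v a0.
  split=> //; apply: bit_inj => b; rewrite bit_zero (valid_bits v).
  by apply/negbTE/negP => /andP[_ /exists_inP[i]]; rewrite inE.
exists (fun _ => 0); split=> //.
- by move=> i; rewrite inE.
- by move=> i j; rewrite inE.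
- move=> b _; rewrite (_ : part _ _ _ = set0) ?connected0 //.
  by apply/setP => i; rewrite !inE.
- by move=> b; rewrite bit_zero; apply/esym/negbTE/negP => /exists_inP[i]; rewrite inE.
by move=> i iE; have := ltn_ord i; rewrite iE ltnn.
Qed.

Lemma act_code_inj : injective (@act_code G).
Proof. by move=> [a|] [b|] //= [] /val_inj->. Qed.

Lemma pref_oracleE (i : player) x k y l :
    (x, k) \in alternative n p -> (y, l) \in alternative n p ->
  Q i (act_code x) k (act_code y) l = pref i (x, k) (y, l).
Proof.
move=> xk yl; apply/existsP/idP => [[j /existsP[x' /existsP[y']]]|ij].
  by case/and5P=> /eqP/val_inj-> /eqP/act_code_inj-> /eqP/act_code_inj-> _ /andP[].
exists i; apply/existsP; exists x; apply/existsP; exists y.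
by rewrite !eqxx xk yl.
Qed.

(** A deviator who leaves the target coalition connected either founds it alone, which [valid_node]
    covers through [U], or is adjacent to one of its members, which [valid_edge] covers. At the root
    no coalition is still growing, so all sizes are actual ones. *)
Lemma Nash_stable_valid (pi : {ffun player -> activity p}) f U :
    (forall i, f i = act_code (pi i)) ->
    (forall b, bit U b = [exists i in setT, f i == b.+1]) ->
  Nash_stable pi <-> valid U n setT 0 1 1 U f.
Proof.
move=> fE UE.
have mE a : members pi a = part f setT a.+1.
  apply/setP => i; rewrite !inE fE -[a.+1]/(act_code (Some a)).
  by rewrite (inj_eq act_code_inj).
have szE i : csize f setT 0 1 (f i) = #|coalition pi i|.
  rewrite /csize /coalition fE; case: (pi i) => [a|] /=; last by rewrite cards1.
  by rewrite -mE.
have szS a : csize f setT 0 1 a.+1 = #|part f setT a.+1| by [].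
have card_le (S : {set player}) : #|S| <= n.
  by rewrite -[X in _ <= X]card_ord max_card.
have alt i : (pi i, #|coalition pi i|) \in alternative n p.
  rewrite inE /= /coalition; case E: (pi i) => [a|]; last by rewrite cards1.
  rewrite card_gt0 card_le andbT.
  by apply/set0Pn; exists i; rewrite inE E.
have alt0 : (None, 1) \in alternative n p by [].
have i0 (i : player) : 0 < n by apply: leq_ltn_trans (ltn_ord i).
(* Outside this range the oracle answers negatively, so each use must bound the size of the enlarged
   coalition by n. *)
have contE (i : player) (a : 'I_p) l : 1 <= l <= n ->
    content i a.+1 l (f i) (csize f setT 0 1 (f i)) =
    ~~ strict_pref i (Some a, l) (pi i, #|coalition pi i|).
  move=> ln; rewrite szE fE /content -[a.+1]/(act_code (Some a)).
  by rewrite !pref_oracleE // inE.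
split=> [/and3P[/forallP feas /forallP ir nodev]|v].
  have nodevP i a : pi i != Some a -> connected (i |: members pi a) ->
      content i a.+1 #|members pi a|.+1 (f i) (csize f setT 0 1 (f i)).
    move=> pia conn; rewrite contE.
      apply: contra nodev => st; apply/existsP; exists i; apply/existsP; exists a.
      by rewrite /NS_deviation eq_sym pia conn.
    by have := card_le (i |: members pi a); rewrite cardsU1 inE pia.
  split=> //.
  - move=> i _; split.
      by rewrite szE fE -[0]/(act_code (None : activity p)) pref_oracleE.
    move=> b bp bU; have bp' : b.-1 < p by lia.
    have bE : b = (Ordinal bp').+1 by rewrite /= prednK //; lia.
    have noU : ~~ [exists i in setT, f i == b].
      have := bU b.-1; rewrite bit_wt; last by lia.
      by rewrite UE prednK ?eqxx //; lia.
    have m0 : members pi (Ordinal bp') = set0 by rewrite mE -bE part_eq0.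
    have := nodevP i (Ordinal bp'); rewrite m0 cards0 setU0 connected1 -bE.
    apply=> //; apply: contra noU => /eqP pii; apply/exists_inP; exists i => //.
    by rewrite fE pii -[act_code _]/(Ordinal bp').+1 -bE.
  - move=> i j _ _ ij; have [fij|fij] := eqVneq (f i) (f j).
      have [f0|f0] := eqVneq (f i) 0; last by left; split=> //; apply/eqP.
      right; apply/negP => /andP[/pref_oracle_dom[_ _ _ /(_ _)]].
      by rewrite -fij f0 => /(_ erefl).
    right; move: fij; rewrite (fE j); case E: (pi j) => [a|] fij; last first.
      by apply/negP => /andP[/pref_oracle_dom[_ _ _ /(_ erefl)]].
    rewrite [act_code _]/= szS -mE; apply: nodevP.
      by apply: contra fij => /eqP pii; rewrite fE pii.
    apply: (connectedU (x := i) (y := j)) ij; rewrite ?inE ?E //.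
      exact: connected1.
    by have := feas j; rewrite /coalition E.
  - move=> b b0.
    have [/exists_inP[i _ /eqP fi]|/part_eq0->] := boolP [exists i in setT, f i == b];
      last exact: connected0.
    have := feas i; rewrite /coalition; move: b0; rewrite -fi fE.
    by case: (pi i) => [a|] //=; rewrite mE.
  by move=> i iE; have := ltn_ord i; rewrite iE ltnn.
apply/and3P; split.
- apply/forallP => i; rewrite /coalition; case: (pi i) => [a|]; last exact: connected1.
  by rewrite mE; apply: (valid_conn v).
- apply/forallP => i; have [] := valid_node v (in_setT i).
  by rewrite szE fE -[0]/(act_code (None : activity p)) pref_oracleE.
apply/existsPn => i; apply/existsPn => a; apply/negP => /and3P[pia conn st].
have iNm : i \notin members pi a by rewrite inE eq_sym.
have mn : #|members pi a| < n.
  by have := card_le (i |: members pi a); rewrite cardsU1 iNm.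
have [m0|/set0Pn[j jm]] := eqVneq (members pi a) set0.
  have [_ /(_ a.+1)] := valid_node v (in_setT i).
  rewrite m0 cards0 in st; rewrite contE ?(i0 i) // st /= => H.
  suff /(H (ltn_ord a)) : bdisj (wt a.+1) U by [].
  move=> b; rewrite bit_wt ?ltn_ord // UE; apply/negP => /andP[/eqP[<-]].
  case/exists_inP=> j _ fj; have : j \in members pi a by rewrite mE !inE fj.
  by rewrite m0 inE.
(* A path from the deviator to a member leaves [i] by an edge to a member. *)
have /connectedP/(_ i j) := conn; rewrite !inE eqxx => /(_ isT).
rewrite [pi j == _](_ : _ = true) ?orbT; last by rewrite inE in jm.
move=> /(_ isT) cij.
have [||u [w [/and3P[_ + uw] /eqP ui wi]]] := connect_cross (P := pred1 i) cij.
- exact: eqxx.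
- by apply: contra iNm => /eqP<-.
have {}wi : w != i by [].
rewrite in_setU1 (negPf wi) /= => wm; rewrite ui in uw.
have fw : f w = a.+1 by rewrite mE inE in wm; apply/eqP; case/andP: wm.
have [[fi _]|] := valid_edge v (in_setT i) (in_setT w) uw.
  by case/negP: iNm; rewrite mE inE inE fi fw /=.
by rewrite fw szS -mE contE ?mn // st.
Qed.

(** The guess is verified at the root: as the final mask has to be [U], [valid_bits] makes [U]
    exactly the set of activities in use. *)
Lemma has_Nash_stableP :
  has_Nash_stable G <-> exists U, sem U n [set: player] 0 1 1 U.
Proof.
split=> [/existsP[pi st]|[U [f v]]].
  pose f i := act_code (pi i).
  have [|U UE] := @bits_exist (fun b => [exists i in setT, f i == b.+1]) p.
    move=> b /exists_inP[i _ /eqP]; rewrite /f; case: (pi i) => //= a [<-].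
    exact: ltn_ord.
  exists U, f; apply: (proj1 (@Nash_stable_valid pi f U _ UE)) => //.
pose pi := [ffun i => if f i is b.+1 then insub b else None : activity p].
apply/existsP; exists pi; apply: (proj2 (@Nash_stable_valid pi f U _ _)) => //.
  move=> i; rewrite /pi ffunE; have := valid_act v (in_setT i).
  by case: (f i) => //= b bp; rewrite insubT.
by move=> b; rewrite (valid_bits v).
Qed.

End Leaves.

(** * The program *)

Fixpoint LGuard (es : seq expr) (c : lcmd) : lcmd :=
  if es is e :: es' then LIf e (LGuard es' c) LSkip else c.

Lemma run_seq o b c1 c2 s : run o b (LSeq c1 c2) s = run o b c2 (run o b c1 s).
Proof. by []. Qed.

Lemma run_assign o b x e s : run o b (LAssign x e) s = setv s x (eval o s e).
Proof. by []. Qed.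

Lemma run_put o b a e1 e2 s :
  run o b (LPut a e1 e2) s = seta s a (eval o s e1) (eval o s e2).
Proof. by []. Qed.

Lemma run_if o b e c1 c2 s :
  run o b (LIf e c1 c2) s =
  if eval o s e != 0 then run o b c1 s else run o b c2 s.
Proof. by []. Qed.

Lemma run_skip o b s : run o b LSkip s = s.
Proof. by []. Qed.

Lemma run_guard o b es c s :
  run o b (LGuard es c) s =
  if all (fun e => eval o s e != 0) es then run o b c s else s.
Proof. by elim: es => //= e es IH; case: ifP => //= _; rewrite IH. Qed.

Definition run_simp :=
  (run_seq, run_assign, run_put, run_if, run_skip, run_guard).

Arguments run : simpl never.
Arguments upd {T} f x v y /.

Lemma arrs_seta s a i v a' j :
  arrs (seta s a i v) a' j =
  if (a' == a) && (j == i) then v else arrs s a' j.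
Proof. by rewrite /=; case: eqP => //= ->. Qed.

Definition eNot e := Defs.Sub (Defs.Num 1) e.
Definition eEq e1 e2 := eNot (Add (Defs.Sub e1 e2) (Defs.Sub e2 e1)).
(** On truth values, truncated subtraction is conjunction with the negation. *)
Definition eStrict i b l a k := Defs.Sub (Query i b l a k) (Query i a k b l).

Lemma eval_not o s e : (eval o s (eNot e) != 0) = (eval o s e == 0).
Proof. by rewrite /=; lia. Qed.

Lemma eval_eq o s e1 e2 : (eval o s (eEq e1 e2) != 0) = (eval o s e1 == eval o s e2).
Proof. by rewrite eval_not /=; lia. Qed.

Lemma eval_strict o s i b l a k :
  (eval o s (eStrict i b l a k) != 0) =
  o (eval o s i) (eval o s b) (eval o s l) (eval o s a) (eval o s k) &&
  ~~ o (eval o s i) (eval o s a) (eval o s k) (eval o s b) (eval o s l).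
Proof. by rewrite /=; case: (o _ _ _ _ _); case: (o _ _ _ _ _). Qed.

Local Notation vp := 1 (only parsing).
Local Notation vS := 2 (only parsing).
Local Notation vn := 3 (only parsing).
Local Notation vm := 4 (only parsing).
Local Notation vcur := 5 (only parsing).
Local Notation vd := 6 (only parsing).
Local Notation vfr := 7 (only parsing).
Local Notation vS4 := 8 (only parsing).
Local Notation vU := 9 (only parsing).
Local Notation vr := 10 (only parsing).
Local Notation vx := 11 (only parsing).
Local Notation vy := 12 (only parsing).
Local Notation vcnt := 13 (only parsing).
Local Notation vj := 14 (only parsing).
Local Notation va := 15 (only parsing).
Local Notation vk := 16 (only parsing).
Local Notation vt := 17 (only parsing).
Local Notation vB := 18 (only parsing).
Local Notation va' := 19 (only parsing).
Local Notation vk' := 20 (only parsing).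
Local Notation vt' := 21 (only parsing).
Local Notation vB' := 22 (only parsing).
Local Notation vflag := 23 (only parsing).
Local Notation vb := 24 (only parsing).

(* There is no multiplication: aT1, aT2 and aT3 list the multiples of S, S^2 and
   S^3, and aR the offsets of the rows of the adjacency matrix.  Array aW holds
   the bits [wt] of the activities, aH halves, and aDU disjointness of bitmasks.
   The table of vertex v is stored in aD from the address aRb[v] on, and aAl
   tells which vertices remain. *)
Local Notation aW := 1 (only parsing).
Local Notation aT1 := 2 (only parsing).
Local Notation aT2 := 3 (only parsing).
Local Notation aT3 := 4 (only parsing).
Local Notation aR := 5 (only parsing).
Local Notation aH := 6 (only parsing).
Local Notation aDU := 7 (only parsing).
Local Notation aD := 8 (only parsing).
Local Notation aRb := 9 (only parsing).
Local Notation aAl := 10 (only parsing).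

Local Notation N := Defs.Num (only parsing).

(** [vcur] holds the factor on entry and S times the factor on exit, so three runs in a row list the
    multiples of S, S^2 and S^3 and leave S^4 behind. *)
Definition table (tab : nat) : lcmd :=
  LSeq (LAssign vd (Var vcur))
    (LSeq (LAssign vcur (N 0))
       (LFor vx (LSeq (LPut tab (Var vx) (Var vcur))
                      (LAssign vcur (Add (Var vcur) (Var vd)))))).

Lemma run_table o tab s (s' := run o vS (table tab) s) :
  (forall x, x < vars s vS -> arrs s' tab x = x * vars s vcur) /\
  vars s' vcur = vars s vS * vars s vcur.
Proof.
rewrite {}/s' /table !run_simp; set s1 := setv _ _ _.
pose I i s' := (forall x, x < i -> arrs s' tab x = x * vars s vcur) /\
  vars s' vcur = i * vars s vcur.
apply: (@run_for_ind o vS vx _ s1 I) => //.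
move=> i s' _ f [IT Ic]; have fd : vars s' vd = vars s vcur by rewrite f.1.
rewrite !run_simp; split; last by rewrite /= Ic fd mulSn addnC.
move=> x; rewrite ltnS leq_eqVlt arrs_setv arrs_seta eqxx /= => /predU1P[->|xi].
  by rewrite eqxx Ic.
by rewrite ltn_eqF // IT.
Qed.

(** The offset 2 skips the numbers n and p at the head of the input word. *)
Definition rows : lcmd :=
  LSeq (LAssign vcur (N 2))
       (LFor vx (LSeq (LPut aR (Var vx) (Var vcur))
                      (LAssign vcur (Add (Var vcur) (Var vn))))).

Lemma run_rows o s (s' := run o vS rows s) :
  forall x, x < vars s vS -> arrs s' aR x = 2 + x * vars s vn.
Proof.
rewrite {}/s' /rows !run_simp; set s1 := setv _ _ _.
pose I i s' := (forall x, x < i -> arrs s' aR x = 2 + x * vars s vn) /\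
  vars s' vcur = 2 + i * vars s vn.
suff [] : I (vars s1 vS) (run o vS (LFor vx (LSeq (LPut aR (Var vx) (Var vcur))
                      (LAssign vcur (Add (Var vcur) (Var vn))))) s1) by [].
apply: run_for_ind => //.
move=> i s' _ f [IT Ic]; have fd : vars s' vn = vars s vn by rewrite f.1.
rewrite !run_simp; split; last by rewrite /= Ic fd; lia.
move=> x; rewrite ltnS leq_eqVlt arrs_setv arrs_seta eqxx /= => /predU1P[->|xi].
  by rewrite eqxx Ic.
by rewrite ltn_eqF // IT.
Qed.

Definition halves : lcmd :=
  LFor vx (LSeq (LPut aH (Add (Var vx) (Var vx)) (Var vx))
                (LPut aH (Add (Add (Var vx) (Var vx)) (N 1)) (Var vx))).

Lemma run_halves o s (s' := run o vS halves s) :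
  forall x, x < vars s vS -> arrs s' aH x = x./2.
Proof.
rewrite {}/s' => x xS.
pose I i s' := forall x, x < i + i -> arrs s' aH x = x./2.
suff H : I (vars s vS) (run o vS halves s) by apply: H; lia.
apply: run_for_ind => // i s' _ _ Ii z zi.
rewrite !run_simp !arrs_seta /=.
case: eqP => [->|z1]; first by lia.
by case: eqP => [->|z2]; rewrite ?Ii //=; lia.
Qed.

Definition eOdd e := Defs.Sub (Defs.Sub e (Get aH e)) (Get aH e).

(** Two masks are disjoint when their last bits are not both 1 and their halves are disjoint. The
    pair of halves comes earlier in the order of the loops, except for (0, 0), which refers to
    itself and is therefore set to 1 beforehand. *)
Definition disjs : lcmd :=
  LSeq (LPut aDU (N 0) (N 1))
    (LFor vx (LFor vy
       (LIf (Defs.Sub (Add (eOdd (Var vx)) (eOdd (Var vy))) (N 1)) LSkip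
          (LPut aDU (Add (Get aT1 (Var vx)) (Var vy))
             (Get aDU (Add (Get aT1 (Get aH (Var vx))) (Get aH (Var vy)))))))).

Lemma mulD_inj S x y x' y' : y < S -> y' < S ->
  x * S + y = x' * S + y' -> x = x' /\ y = y'.
Proof.
by move=> yS y'S /(congr1 (edivn^~ S)); rewrite !edivn_eq // => -[].
Qed.

Lemma run_disjs o s (s' := run o vS disjs s) (S := vars s vS) :
    (forall i, arrs s aDU i = 0) ->
    (forall x, x < S -> arrs s aT1 x = x * S) ->
    (forall x, x < S -> arrs s aH x = x./2) ->
  forall x y, x < S -> y < S -> arrs s' aDU (x * S + y) != 0 <-> bdisj x y.
Proof.
move=> D0 T1 H x y xS yS; rewrite {}/s' /disjs run_simp.
set s1 := run _ _ (LPut _ _ _) s.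
set c := LFor vx _.
pose ok s' u v := arrs s' aDU (u * S + v) != 0 <-> bdisj u v.
(* The last clause keeps entries not yet reached at 0, the right answer when both numbers are
   odd. *)
pose I u s' := [/\ forall u' v, u' < u -> v < S -> ok s' u' v,
  u = 0 -> arrs s' aDU 0 = 1 &
  forall u' v, u <= u' -> v < S -> 0 < u' + v -> arrs s' aDU (u' * S + v) = 0].
suff [] : I (vars s1 vS) (run o vS c s1) by move=> K _ _; apply: K.
apply: run_for_ind => //; first last.
  move=> u s2 uS f [I1 I2 I3].
  rewrite [vars s1 vS]/= -/S in uS.
  pose J w s' := [/\ forall u' v, u' < u -> v < S -> ok s' u' v,
    forall v, v < w -> ok s' u v,
    u = 0 -> w = 0 -> arrs s' aDU 0 = 1,
    forall v, w <= v -> v < S -> 0 < u + v -> arrs s' aDU (u * S + v) = 0 &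
    forall u' v, u < u' -> v < S -> arrs s' aDU (u' * S + v) = 0].
  set s2x := setv s2 vx u; have s2S : vars s2x vS = S by rewrite /= f.1.
  set cc := LFor vy _.
  suff [J1 J2 _ _ J5] : J (vars s2x vS) (run o vS cc s2x).
    rewrite s2S in J2; split=> //.
      by move=> u' v; rewrite ltnS leq_eqVlt => /predU1P[->|u'u] vS; [apply: J2|apply: J1].
    by move=> u' v uu' vS _; apply: J5.
  apply: run_for_ind.
  - split=> //; first by move=> u0 _; apply: I2.
      by move=> v _ vS uv; apply: I3.
    by move=> u' v uu' vS; apply: I3 => //; [apply: ltnW | lia].
  - move=> w s3 wS g [J1 J2 J3 J4 J5]; rewrite s2S in wS.
    have x3 : vars s3 vx = u by rewrite g.1.
    have T3 z : z < S -> arrs s3 aT1 z = z * S.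
      by move=> zS; rewrite g.2 //= f.2 //= T1.
    have H3 z : z < S -> arrs s3 aH z = z./2.
      by move=> zS; rewrite g.2 //= f.2 //= H.
    rewrite !run_simp /= x3 !(H3 u, H3 w) //.
    have odE z : z - z./2 - z./2 = odd z by rewrite -subnDA addnn -{1}[z]odd_double_half addnK.
    rewrite !odE.
    have -> : (odd u + odd w - 1 != 0) = odd u && odd w by case: (odd u) (odd w) => [] [].
    case: ifP => oo.
      split.
      + by move=> u' v u'u vS; apply: J1.
      + move=> v; rewrite ltnS leq_eqVlt => /predU1P[->|]; last exact: J2.
        split; last by case/bdisj_half; rewrite oo.
        rewrite [arrs _ _ _]/= J4 //; move: oo; case: (u) => //= *; lia.
      + by [].
      + by move=> v wv; apply: J4; exact: ltnW.
      + by [].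
    set s4 := seta _ _ _ _.
    have s4E j : arrs s4 aDU j = if j == u * S + w
        then arrs s3 aDU (u./2 * S + w./2) else arrs s3 aDU j.
      rewrite /s4 arrs_seta /= T3 // !T3 //; lia.
    have neq u' v : v < S -> (u', v) != (u, w) -> (u' * S + v == u * S + w) = false.
      move=> vS; rewrite xpair_eqE => /negP uv; apply/negP => /eqP /mulD_inj.
      by case=> // ? ?; apply: uv; apply/andP; split; apply/eqP.
    split.
    + move=> u' v u'u vS; rewrite /ok s4E neq ?J1 //; first exact: J1.
      by rewrite xpair_eqE negb_and ltn_eqF.
    + move=> v; rewrite ltnS leq_eqVlt => /predU1P[->|vw]; last first.
        rewrite /ok s4E neq; [exact: J2 | exact: ltn_trans wS |].
        by rewrite xpair_eqE negb_and (ltn_eqF vw) orbT.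
      rewrite /ok s4E eqxx.
      have -> : bdisj u w <-> bdisj u./2 w./2.
        by split=> [/bdisj_half[]//|d]; apply/bdisj_half; rewrite oo.
      have [u0|u0] := posnP u; last by apply: J1; lia.
      have [w0|w0] := posnP w; last by rewrite u0; rewrite u0 in J2; apply: J2; lia.
      by rewrite u0 w0 J3 //; split=> // _; exact: bdisj0.
    + by [].
    + move=> v wv vS uv; rewrite s4E neq ?J4 //; first exact: ltnW.
      by rewrite xpair_eqE negb_and (gtn_eqF wv) orbT.
    + move=> u' v u'u vS; rewrite s4E neq ?J5 //.
      by rewrite xpair_eqE negb_and (gtn_eqF u'u).
  by move=> s3 w [J1 J2 J3 J4 J5]; split.
rewrite /s1 !run_simp /=; split=> // [u' v _ vS uv].
by rewrite arrs_seta /= D0; case: eqP => //; nia.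
Qed.

(** An address in base S with the digits [a], [k], [t], [B], relative to the start [r] of the
    block. *)
Definition eRow r a k t B :=
  Add r (Add (Get aT3 a) (Add (Get aT2 k) (Add (Get aT1 t) B))).

Definition eDisj e1 e2 := Get aDU (Add (Get aT1 e1) e2).

Definition preparation : lcmd :=
  LSeq (LAssign vcur (Var vS))
  (LSeq (table aT1)
  (LSeq (table aT2)
  (LSeq (table aT3)
  (LSeq (LAssign vS4 (Var vcur))
  (LSeq rows
  (LSeq halves disjs)))))).

Definition node_row : lcmd :=
  LSeq (LAssign vflag (N 1))
  (LSeq (LFor vb
     (LGuard [:: eDisj (Get aW (Var vb)) (Var vU);
                 eStrict (Var vx) (Var vb) (N 1) (Var va) (Var vk)]
        (LAssign vflag (N 0))))
     (LGuard [:: Var vflag; Query (Var vx) (Var va) (Var vk) (N 0) (N 1)]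
        (LPut aD (eRow (Get aRb (Var vx)) (Var va) (Var vk) (N 1) (N 0)) (N 1)))).

(** Blocks of S^4 cells are handed out by the free pointer [vfr]. Truncated subtraction makes
    [aAl[v]] nonzero exactly for the players. The virtual player fails the query of [node_row] and
    receives the single tuple (0, 1, 1, 0). *)
Definition initial : lcmd :=
  LFor vx
    (LSeq (LPut aRb (Var vx) (Var vfr))
    (LSeq (LAssign vfr (Add (Var vfr) (Var vS4)))
    (LSeq (LPut aAl (Var vx) (Defs.Sub (Var vn) (Var vx)))
    (LSeq (LFors [:: va; vk] node_row)
       (LGuard [:: eEq (Var vx) (Var vn)]
          (LPut aD (eRow (Get aRb (Var vx)) (N 0) (N 1) (N 1) (N 0)) (N 1))))))).

Definition join_guard : seq expr :=
  [:: eEq (Var va) (Var va'); Var va; eEq (Var vk) (Var vk');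
      eDisj (Var vB) (Var vB')].

Definition join_put : lcmd :=
  LPut aD (eRow (Var vfr) (Var va') (Var vk') (Add (Var vt) (Var vt'))
             (Add (Var vB) (Var vB'))) (N 1).

Definition split_guard : seq expr :=
  [:: eEq (Var vt) (Var vk);
      eDisj (Add (Var vB) (Get aW (Var va))) (Add (Var vB') (Get aW (Var va')));
      eNot (eStrict (Var vx) (Var va') (Add (Var vk') (N 1)) (Var va) (Var vk));
      eNot (eStrict (Var vy) (Var va) (Add (Var vk) (N 1)) (Var va') (Var vk'))].

Definition split_put : lcmd :=
  LPut aD (eRow (Var vfr) (Var va') (Var vk') (Var vt')
             (Add (Add (Var vB) (Get aW (Var va))) (Var vB'))) (N 1).

Definition combine : lcmd :=
  LGuard
    [:: Get aD (eRow (Get aRb (Var vx)) (Var va) (Var vk) (Var vt) (Var vB));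
        Get aD (eRow (Get aRb (Var vy)) (Var va') (Var vk') (Var vt') (Var vB'))]
    (LSeq (LGuard join_guard join_put) (LGuard split_guard split_put)).

(** The merged table goes to a fresh block to which [y] is redirected, so no cell ever has to be
    cleared. *)
Definition merge_rows : lcmd :=
  LSeq (LPut aAl (Var vx) (N 0))
  (LSeq (LFors [:: va; vk; vt; vB; va'; vk'; vt'; vB'] combine)
  (LSeq (LPut aRb (Var vy) (Var vfr))
        (LAssign vfr (Add (Var vfr) (Var vS4))))).

(** Without a remaining neighbour [vy] keeps the value [n], so isolated vertices are merged into the
    virtual player by the same code. *)
Definition neighbours : lcmd :=
  LSeq (LAssign vcnt (N 0))
  (LSeq (LAssign vy (Var vn))
     (LFor vj (LGuard [:: Get aAl (Var vj); Get 0 (Add (Get aR (Var vx)) (Var vj))]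
        (LSeq (LAssign vcnt (Add (Var vcnt) (N 1)))
              (LAssign vy (Var vj)))))).

Definition visit : lcmd :=
  LGuard [:: Get aAl (Var vx)]
    (LSeq neighbours (LGuard [:: Defs.Sub (N 2) (Var vcnt)] merge_rows)).

Definition elimination : lcmd := LFor vr (LFors [:: vx] visit).

Definition attempt : lcmd :=
  LSeq initial
  (LSeq elimination
     (LGuard [:: Get aD (eRow (Get aRb (Var vn)) (N 0) (N 1) (N 1) (Var vU))]
        (LAssign 0 (N 1)))).

Definition solve : lcmd := LSeq preparation (LFors [:: vU] attempt).

(** * Auxiliary arrays and addresses of table entries *)

Section Tables.

Variable G : gGASP.
Local Notation n := (nplayers G).
Local Notation p := (nacts G).
Local Notation wt := (wt G).

(** It exceeds every mask, activity and coalition size that can occur, and every vertex number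
    including the virtual [n]. *)
Definition range : nat := 2 ^ p + n + 1.

Local Notation S := range.

(** Data that nothing after [preparation] overwrites, hence transported by [frame]. The halves are
    absent, as they only serve to fill [aDU]. *)
Record static (s : store) : Prop := Static {
  st_S : vars s vS = S;
  st_n : vars s vn = n;
  st_S4 : vars s vS4 = S * (S * (S * S));
  st_in : forall j, arrs s 0 j = nth 0 (encode_gGASP G) j;
  st_W : forall b, arrs s aW b = wt b;
  st_T1 : forall x, x < S -> arrs s aT1 x = x * S;
  st_T2 : forall x, x < S -> arrs s aT2 x = x * (S * S);
  st_T3 : forall x, x < S -> arrs s aT3 x = x * (S * (S * S));
  st_R : forall x, x < S -> arrs s aR x = 2 + x * n;
  st_DU : forall x y, x < S -> y < S ->
    arrs s aDU (x * S + y) != 0 <-> bdisj x y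
}.

Lemma static_frame c s s' : frame c s s' ->
    all [predC avars c] [:: 2; 3; 8] ->
    all [predC aarrs c] [:: 0; 1; 2; 3; 4; 5; 7] ->
  static s -> static s'.
Proof.
move=> [fv fa] /and4P[v2 v3 v8 _] /and5P[a0 a1 a2 a3 /and4P[a4 a5 a7 _]] [].
by split; rewrite ?(fv 2) ?(fv 3) ?(fv 8) ?(fa 0) ?(fa 1) ?(fa 2) ?(fa 3) ?(fa 4) ?(fa 5) ?(fa 7).
Qed.

Lemma static_setv s x v : x \notin [:: 2; 3; 8] -> static s -> static (setv s x v).
Proof.
move=> xs; apply: (@static_frame (LAssign x (N 0))) => //.
  by apply: frame_setv (frame_refl _ _); rewrite inE.
by move: xs; rewrite !inE !negb_or /= !inE ![_ == x]eq_sym => /and3P[-> -> ->].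
Qed.

Definition slot (a k t B : nat) : nat :=
  a * (S * (S * S)) + (k * (S * S) + (t * S + B)).

Lemma slot_inj a k t B a' k' t' B' :
    k < S -> t < S -> B < S -> k' < S -> t' < S -> B' < S ->
    slot a k t B = slot a' k' t' B' ->
  [/\ a = a', k = k', t = t' & B = B'].
Proof.
rewrite /slot !mulnA => kS tS BS k'S t'S B'S.
rewrite !addnA -!mulnDl => /mulD_inj[] // /mulD_inj[] // /mulD_inj[] //.
Qed.

Lemma slot_lt a k t B :
  a < S -> k < S -> t < S -> B < S -> slot a k t B < S * (S * (S * S)).
Proof.
rewrite /slot; move: S => R aR kR tR BR.
have h m x y : x < R -> y < m -> x * m + y < R * m.
  by move=> xR ym; apply: (@leq_trans (x.+1 * m)); rewrite ?leq_mul2r ?xR ?orbT // mulSn; lia.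
by apply: (h) => //; apply: (h) => //; apply: h.
Qed.

Lemma eval_row o s r a k t B : static s ->
    eval o s a < S -> eval o s k < S -> eval o s t < S ->
  eval o s (eRow r a k t B) =
  eval o s r + slot (eval o s a) (eval o s k) (eval o s t) (eval o s B).
Proof. by move=> st aS kS tS; rewrite /= (st_T1 st) // (st_T2 st) // (st_T3 st). Qed.

Lemma eval_disj o s e1 e2 : static s -> eval o s e1 < S -> eval o s e2 < S ->
  eval o s (eDisj e1 e2) != 0 <-> bdisj (eval o s e1) (eval o s e2).
Proof. by move=> st e1S e2S; rewrite /= (st_T1 st) //; exact: (st_DU st). Qed.

Lemma run_preparation o s :
    vars s vS = S -> vars s vn = n ->
    (forall j, arrs s 0 j = nth 0 (encode_gGASP G) j) ->
    (forall b, arrs s aW b = wt b) -> (forall j, arrs s aDU j = 0) ->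
  static (run o vS preparation s).
Proof.
move=> sS sn sin sW sD; rewrite /preparation run_seq run_assign.
set s0 := setv _ _ _.
rewrite run_seq; have [t1 c1] := run_table o aT1 s0; have f1 := run_frame o vS (table aT1) s0.
set s1 := run o vS (table aT1) s0 in t1 c1 f1 *; clearbody s1.
rewrite run_seq; have [t2 c2] := run_table o aT2 s1; have f2 := run_frame o vS (table aT2) s1.
set s2 := run o vS (table aT2) s1 in t2 c2 f2 *; clearbody s2.
rewrite run_seq; have [t3 c3] := run_table o aT3 s2; have f3 := run_frame o vS (table aT3) s2.
set s3 := run o vS (table aT3) s2 in t3 c3 f3 *; clearbody s3.
have S1 : vars s1 vS = S by rewrite f1.1.
have S2 : vars s2 vS = S by rewrite f2.1.
have S3 : vars s3 vS = S by rewrite f3.1.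
rewrite run_seq run_assign; set s4 := setv _ _ _.
rewrite run_seq; have r5 := run_rows o (s := s4); have f5 := run_frame o vS rows s4.
set s5 := run o vS rows s4 in r5 f5 *; clearbody s5.
have S5 : vars s5 vS = S by rewrite f5.1.
rewrite run_seq; have h6 := run_halves o (s := s5); have f6 := run_frame o vS halves s5.
set s6 := run o vS halves s5 in h6 f6 *; clearbody s6.
have S6 : vars s6 vS = S by rewrite f6.1.
have d7 := run_disjs o (s := s6); have f7 := run_frame o vS disjs s6.
set s7 := run o vS disjs s6 in d7 f7 *; clearbody s7.
have a7 z : z \notin [:: 2; 3; 4; 5; 6; 7] -> arrs s7 z = arrs s z.
  rewrite !inE !negb_or => /and5P[z2 z3 z4 z5 /andP[z6 z7]].
  rewrite f7.2 ?f6.2 ?f5.2 /s4 /= ?f3.2 ?f2.2 ?f1.2 //= !inE ?negb_or ?z6 ?z7 //.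
have n4 : vars s4 vn = n by rewrite /s4 /= f3.1 // f2.1 // f1.1.
have T1 x : x < S -> arrs s6 aT1 x = x * S.
  by move=> xS; rewrite f6.2 // f5.2 // /s4 arrs_setv f3.2 // f2.2 // t1 /= sS.
split.
- by rewrite f7.1.
- by rewrite f7.1 // f6.1 // f5.1.
- by rewrite f7.1 // f6.1 // f5.1 // /s4 /= c3 S2 c2 S1 c1 /= sS.
- by move=> j; rewrite a7.
- by move=> b; rewrite a7.
- by move=> x xS; rewrite f7.2 // T1.
- move=> x xS; rewrite f7.2 // f6.2 // f5.2 // /s4 arrs_setv f3.2 // t2 ?S1 // c1 /= sS //.
- move=> x xS; rewrite f7.2 // f6.2 // f5.2 // /s4 arrs_setv t3 ?S2 // c2 S1 c1 /= sS //.
- by move=> x xS; rewrite f7.2 // f6.2 // r5 /s4 /= ?S3 // f3.1 // f2.1 // f1.1 //= sn.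
move=> x y xS yS; rewrite -S6; apply: d7; rewrite ?S6 //.
- by move=> i; rewrite f6.2 // f5.2 // /s4 arrs_setv f3.2 // f2.2 // f1.2 //; exact: sD.
by move=> z zS; rewrite h6 // S5.
Qed.

End Tables.

(** * Correctness of the initial and of the merged tables *)

Section Rows.

Variable G : gGASP.
Local Notation n := (nplayers G).
Local Notation p := (nacts G).
Local Notation player := 'I_(nplayers G).
Local Notation Q := (@pref_oracle G).
Local Notation wt := (wt G).
Local Notation content := (content G).
Local Notation node_ok := (node_ok G).
Local Notation S := (range G).
Local Notation static := (static G).
Local Notation slot := (slot G).

Local Notation row_size := (S * (S * (S * S))).

Definition row_spec (s : store) (r U y : nat) (X : {set player}) : Prop :=
  forall a k t B, a < S -> k < S -> t < S -> B < S ->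
    arrs s aD (r + slot a k t B) != 0 <-> sem U y X a k t B.

Definition blank (s : store) (r : nat) : Prop := forall j, r <= j -> arrs s aD j = 0.

Lemma exp2_lt_range : 2 ^ p < S.
Proof. by rewrite /range; lia. Qed.

Lemma acts_lt_range : p < S.
Proof. by have := ltn_expl p (isT : 1 < 2); rewrite /range; lia. Qed.

Lemma players_lt_range : maxn n 1 < S.
Proof.
have : 0 < 2 ^ p by rewrite expn_gt0.
by rewrite /range; lia.
Qed.

Lemma wt_lt_range b : wt b < S.
Proof. exact: ltn_trans (wt_lt _ _) exp2_lt_range. Qed.

Lemma run_node_row U x a k s r :
    static s -> vars s vU = U -> vars s vx = x -> vars s va = a ->
    vars s vk = k -> arrs s aRb x = r -> U < S -> a < S -> k < S ->
  exists2 b : bool, b <-> node_ok U x a k &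
    forall j, arrs (run Q vS node_row s) aD j =
      if b && (j == r + slot a k 1 0) then 1 else arrs s aD j.
Proof.
move=> st sU sx sa sk sr US aS kS.
rewrite /node_row run_seq run_assign; set s1 := setv _ _ _; rewrite run_seq.
set c := LFor vb _.
have st1 : static s1 by apply: static_setv.
have f2 := run_frame Q vS c s1.
have : vars (run Q vS c s1) vflag != 0 <->
    forall b', b' < S -> bdisj (wt b') U -> content x b' 1 a k.
  have S1 : vars s1 vS = S by rewrite (st_S st1).
  rewrite -S1; pose I b s' := (vars s' vflag != 0) <->
    forall b', b' < b -> bdisj (wt b') U -> content x b' 1 a k.
  apply: (@run_for_ind Q vS vb _ s1 I) => // b s' bS f I'.
  set s2 := setv s' vb b.
  have st2 : static s2.
    by apply: static_setv => //; apply: static_frame f _ _ st1.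
  have v2 z : z \notin avars c -> vars s2 z = vars s1 z.
    move=> zc; rewrite vars_setv ifN ?f.1 //.
    by apply: contraNneq zc => ->; rewrite inE.
  have xE : vars s2 vx = x by rewrite v2 //= sx.
  have aE : vars s2 va = a by rewrite v2 //= sa.
  have kE : vars s2 vk = k by rewrite v2 //= sk.
  have UE : vars s2 vU = U by rewrite v2 //= sU.
  have bE : vars s2 vb = b by [].
  have flE : vars s2 vflag = vars s' vflag by [].
  rewrite -/s2; clearbody s2.
  have wE : eval Q s2 (Get aW (Var vb)) = wt b by rewrite /= (st_W st2) bE.
  have dE : eval Q s2 (eDisj (Get aW (Var vb)) (Var vU)) != 0 <-> bdisj (wt b) U.
    by rewrite -wE -UE; apply: (eval_disj st2); rewrite ?wE ?wt_lt_range //= UE.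
  have sE : (eval Q s2 (eStrict (Var vx) (Var vb) (N 1) (Var va) (Var vk)) != 0)
      = ~~ content x b 1 a k.
    by rewrite eval_strict /content negbK /= xE aE kE bE.
  rewrite run_guard; case: ifP => [/and3P[/dE bU nc _]|gd].
    rewrite run_assign /I /=; split=> // H.
    by have := H b (ltnSn b) bU; rewrite sE in nc; rewrite (negPf nc).
  rewrite /I flE; split=> [/I' H b'|H]; last by apply/I' => b' b'b; apply: H; exact: ltnW.
  rewrite ltnS leq_eqVlt => /predU1P[->|]; last exact: H.
  move/dE => bU; move: gd; rewrite -[all _ _]/[&& _, _ & _] sE.
  by rewrite bU andbT => /negbFE.
set s2 := run Q vS c s1 in f2 *; clearbody s2 => flagE.
have st2 : static s2 by apply: static_frame f2 _ _ st1.
have xE : vars s2 vx = x by rewrite f2.1 //= sx.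
have aE : vars s2 va = a by rewrite f2.1 //= sa.
have kE : vars s2 vk = k by rewrite f2.1 //= sk.
exists ((vars s2 vflag != 0) && Q x a k 0 1).
  split=> [/andP[/flagE H Qx]|[Qx H]].
    split=> // b bp; apply: H; have := acts_lt_range; lia.
  rewrite Qx andbT; apply/flagE => b bS bU.
  (* The program also tries [b = 0], harmless by individual rationality, and [b > p], for which the
     query fails. *)
  have [bp|bp] := boolP (0 < b <= p); first exact: H.
  apply/negP => /andP[Qb]; case/negP; have [_ bp' _ b1] := pref_oracle_dom Qb.
  by have -> : b = 0 by lia.
move=> j; rewrite run_guard.
rewrite [all _ _]/= xE aE kE andbT; case: (vars s2 vflag != 0) => /=; last by rewrite f2.2.
case: (Q x a k 0 1) => /=; last by rewrite f2.2.
have S1 : 1 < S by have := players_lt_range; lia.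
by rewrite xE aE kE (st_T1 st2) // (st_T2 st2) // (st_T3 st2) // !f2.2 // [arrs s1 _ x]sr.
Qed.

(** A pattern repeated for [combine]: an invariant shows that every nonzero cell is justified, and
    [run_fors_hit] that every justified cell gets set, because no round resets one. *)
Lemma run_node_rows U x s r :
    static s -> vars s vU = U -> vars s vx = x -> arrs s aRb x = r -> U < S ->
    blank s r ->
  let s' := run Q vS (LFors [:: va; vk] node_row) s in
  [/\ forall j, j < r -> arrs s' aD j = arrs s aD j, blank s' (r + row_size) &
    forall a k t B, a < S -> k < S -> t < S -> B < S ->
      arrs s' aD (r + slot a k t B) != 0 <-> [/\ node_ok U x a k, t = 1 & B = 0]].
Proof.
move=> st sU sx sr US bl s'.
have S1 : 1 < S by have := players_lt_range; lia.
pose I s' := [/\ forall j, j < r -> arrs s' aD j = arrs s aD j, blank s' (r + row_size) &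
    forall a k t B, a < S -> k < S -> t < S -> B < S ->
      arrs s' aD (r + slot a k t B) != 0 -> [/\ node_ok U x a k, t = 1 & B = 0]].
have step s2 : frame (LFors [:: va; vk] node_row) s s2 ->
    vars s2 va < S -> vars s2 vk < S ->
    exists2 b : bool, b <-> node_ok U x (vars s2 va) (vars s2 vk) &
    forall j, arrs (run Q vS node_row s2) aD j =
      if b && (j == r + slot (vars s2 va) (vars s2 vk) 1 0) then 1 else arrs s2 aD j.
  move=> f aS kS; apply: run_node_row => //.
  - exact: static_frame f _ _ st.
  - by rewrite f.1.
  - by rewrite f.1.
  by rewrite f.2.
have I0 : I s.
  split=> // [j rj|a k t B _ _ _ _]; first by apply: bl; lia.
  by rewrite bl //; lia.
have IS s2 : frame (LFors [:: va; vk] node_row) s s2 -> in_range vS [:: va; vk] s s2 ->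
    I s2 -> I (run Q vS node_row s2).
  rewrite /in_range /= (st_S st) => f /and3P[aS kS _] [I1 I2 I3].
  have [b bP DE] := step s2 f aS kS; have sl := slot_lt aS kS S1 (ltnW S1).
  split.
  - by move=> j jr; rewrite DE I1 //; case: eqP; rewrite ?andbF //; lia.
  - by move=> j jr; rewrite DE I2 //; case: eqP; rewrite ?andbF //; lia.
  move=> a k t B aS' kS' tS' BS'; rewrite DE; case: ifP => [|_]; last exact: I3.
  case/andP=> bT /eqP/addnI/slot_inj[] // ; try lia.
  by move=> -> -> -> -> _; split=> //; apply/bP.
have [I1 I2 I3] : I s' by apply: run_fors_inv.
split=> // a k t B aS kS tS BS; split=> [|[ok -> ->]]; first exact: I3.
pose K s2 := arrs s2 aD (r + slot a k 1 0) != 0.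
apply: (@run_fors_hit Q vS [:: va; vk] node_row s [:: a; k] I K) => //.
- by rewrite (st_S st) /= aS kS.
- move=> s2 f rg _; rewrite /K.
  move: rg; rewrite /in_range /= (st_S st) => /and3P[aS' kS' _].
  by have [b _ ->] := step s2 f aS' kS'; case: ifP.
move=> s2 f _ /= [aE kE]; rewrite /K.
have [|| b bP ->] := step s2 f; rewrite ?aE ?kE //.
by move: bP; rewrite aE kE eqxx => -[_ /(_ ok) ->].
Qed.

Lemma row_spec_ext s s' r U y X :
    (forall j, j < r + row_size -> arrs s' aD j = arrs s aD j) ->
  row_spec s r U y X -> row_spec s' r U y X.
Proof.
move=> e rs a k t B aS kS tS BS; rewrite e; first exact: rs.
by rewrite ltn_add2l slot_lt.
Qed.

Definition self (v : nat) : {set player} := [set i : player | i == v :> nat].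

Lemma run_initial U s :
    static s -> vars s vU = U -> U < S -> blank s (vars s vfr) ->
  let s' := run Q vS initial s in
  blank s' (vars s' vfr) /\
  forall v, v < S -> [/\ arrs s' aRb v + row_size <= vars s' vfr,
    v <= n -> row_spec s' (arrs s' aRb v) U v (self v) &
    (arrs s' aAl v != 0) = (v < n)].
Proof.
move=> st sU US bl; have S1 : 1 < S by have := players_lt_range; lia.
pose I i s' := blank s' (vars s' vfr) /\
  forall v, v < i -> [/\ arrs s' aRb v + row_size <= vars s' vfr,
    v <= n -> row_spec s' (arrs s' aRb v) U v (self v) &
    (arrs s' aAl v != 0) = (v < n)].
move=> s'; rewrite -{1}(st_S st).
suff [? ?] : I (vars s vS) s' by split.
apply: run_for_ind => // i s2 iS f [I1 I2]; rewrite (st_S st) in iS.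
rewrite !run_seq !(run_put, run_assign).
set s3 := seta _ _ _ _.
have st2 : static s2 by apply: static_frame f _ _ st.
have st3 : static s3.
  by case: st2 => *; split.
set r := vars s2 vfr in I1 I2.
have s3r : arrs s3 aRb i = r by rewrite /s3 !(arrs_seta, arrs_setv) /= eqxx.
have s3fr : vars s3 vfr = r + row_size by rewrite /s3 /= (st_S4 st2).
have s3D j : arrs s3 aD j = arrs s2 aD j by [].
have s3U : vars s3 vU = U by rewrite /s3 /= f.1.
have s3x : vars s3 vx = i by [].
have s3Rb v : v < i -> arrs s3 aRb v = arrs s2 aRb v.
  by move=> vi; rewrite /s3 !(arrs_seta, arrs_setv) /= (ltn_eqF vi).
have s3Al v : v < i -> arrs s3 aAl v = arrs s2 aAl v.
  by move=> vi; rewrite /s3 !(arrs_seta, arrs_setv) /= (ltn_eqF vi).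
have s3Ali : arrs s3 aAl i = n - i.
  by rewrite /s3 !(arrs_seta, arrs_setv) /= eqxx (st_n st2).
have bl3 : blank s3 r by move=> j rj; rewrite s3D I1.
clearbody s3.
have [J1 J2 J3] := run_node_rows st3 s3U s3x s3r US bl3.
set c := LFors _ _ in J1 J2 J3 *.
have f4 := run_frame Q vS c s3.
set s4 := run Q vS c s3 in J1 J2 J3 f4 *; clearbody s4.
have st4 : static s4 by apply: static_frame f4 _ _ st3.
have s4x : vars s4 vx = i by rewrite f4.1.
set c5 := LGuard _ _; set s5 := run Q vS c5 s4.
have f5 : frame c5 s4 s5 by apply: run_frame.
have s5Rb v : arrs s5 aRb v = arrs s3 aRb v by rewrite f5.2 // f4.2.
have s5Al v : arrs s5 aAl v = arrs s3 aAl v by rewrite f5.2 // f4.2.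
have s5fr : vars s5 vfr = r + row_size by rewrite f5.1 // f4.1.
have s5D j : arrs s5 aD j =
    if (i == n) && (j == r + slot 0 1 1 0) then 1 else arrs s4 aD j.
  rewrite /s5 /c5 run_guard [all _ _]/= -[_ != 0]/(eval Q s4 (eEq (Var vx) (Var vn)) != 0).
  rewrite eval_eq andbT /= s4x (st_n st4); case: (i == n) => //.
  rewrite run_put arrs_seta /= s4x f4.2 // s3r.
  by rewrite (st_T1 st4) // (st_T2 st4) // (st_T3 st4) //; lia.
clearbody s5.
have sl : slot 0 1 1 0 < row_size by rewrite slot_lt //; lia.
have below j : j < r -> arrs s5 aD j = arrs s2 aD j.
  by move=> jr; rewrite s5D J1 // s3D; case: eqP => // ?; case: eqP => //; lia.
split.
  by rewrite s5fr => j rj; rewrite s5D J2 //; case: eqP => // ?; case: eqP => //; lia.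
move=> v; rewrite ltnS leq_eqVlt s5Rb s5Al s5fr => /predU1P[->|vi].
  rewrite s3r s3Ali; split=> //; last by rewrite subn_eq0 -ltnNge.
  rewrite leq_eqVlt => /predU1P[iN|iN] a k t B aS kS tS BS.
    rewrite s5D iN eqxx /=.
    have -> : self n = set0.
      by apply/setP => u; rewrite !inE ltn_eqF.
    have noleaf : ~ (arrs s4 aD (r + slot a k t B) != 0).
      move/(J3 _ _ _ _ aS kS tS BS) => [[Qi _] _ _].
      by have [] := pref_oracle_dom Qi; rewrite iN ltnn.
    rewrite sem_root eqn_add2l; case: (slot a k t B =P slot 0 1 1 0) => [e|ne].
      by have [-> -> -> ->] := slot_inj kS tS BS S1 S1 (ltnW S1) e.
    by split=> // -[a0 k1 t1 B0]; case: ne; rewrite a0 k1 t1 B0.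
  rewrite s5D (ltn_eqF iN) /=.
  have -> : self i = [set Ordinal iN].
    by apply/setP => u; rewrite !inE.
  rewrite -[i]/(nat_of_ord (Ordinal iN)) sem_leaf; exact: J3.
have [K1 K2 K3] := I2 v vi; rewrite s3Rb // s3Al //; split=> //.
  by apply: leq_trans K1 _; rewrite leq_addr.
move=> /K2; apply: row_spec_ext => j jr; apply: below; exact: leq_trans jr K1.
Qed.

Lemma join_guardP s :
    static s -> vars s vB < S -> vars s vB' < S ->
  all (fun e => eval Q s e != 0) join_guard <->
  [/\ vars s va = vars s va', vars s va <> 0, vars s vk = vars s vk' &
      bdisj (vars s vB) (vars s vB')].
Proof.
move=> st BS BS'; have dP := @eval_disj G Q s (Var vB) (Var vB') st BS BS'.
split=> [/and5P[]|[aa a0 kk d]]; last first.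
  apply/and5P; split=> //; rewrite ?eval_eq; do ?exact/eqP.
  exact/dP.
by rewrite !eval_eq => /eqP aa /eqP a0 /eqP kk /dP d _.
Qed.

Lemma split_guardP s :
    static s -> vars s vB + wt (vars s va) < S -> vars s vB' + wt (vars s va') < S ->
  all (fun e => eval Q s e != 0) split_guard <->
  [/\ vars s vt = vars s vk,
      bdisj (vars s vB + wt (vars s va)) (vars s vB' + wt (vars s va')),
      content (vars s vx) (vars s va') (vars s vk').+1 (vars s va) (vars s vk) &
      content (vars s vy) (vars s va) (vars s vk).+1 (vars s va') (vars s vk')].
Proof.
move=> st BS BS'.
have e1 : eval Q s (Add (Var vB) (Get aW (Var va))) = vars s vB + wt (vars s va).
  by rewrite /= (st_W st).
have e2 : eval Q s (Add (Var vB') (Get aW (Var va'))) = vars s vB' + wt (vars s va').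
  by rewrite /= (st_W st).
have dP := @eval_disj G Q s (Add (Var vB) (Get aW (Var va)))
  (Add (Var vB') (Get aW (Var va'))) st.
rewrite e1 e2 in dP; have {}dP := dP BS BS'.
have cP i b l a k : (eval Q s (eNot (eStrict (Var i) (Var b) (Add (Var l) (N 1)) (Var a) (Var k))) != 0) =
    content (vars s i) (vars s b) (vars s l).+1 (vars s a) (vars s k).
  rewrite eval_not -[_ == 0]negbK eval_strict /content /= addn1 //.
split=> [/and5P[]|[tk d c1 c2]]; last first.
  apply/and5P; split; rewrite ?cP //; first by rewrite eval_eq; apply/eqP.
  exact/dP.
by rewrite !cP eval_eq => /eqP tk /dP d c1 c2 _.
Qed.

Lemma combine_mono s j :
  arrs s aD j != 0 -> arrs (run Q vS combine s) aD j != 0.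
Proof.
rewrite /combine run_guard; case: ifP => // _; rewrite run_seq !run_guard.
have put s' e : arrs s' aD j != 0 -> arrs (run Q vS (LPut aD e (N 1)) s') aD j != 0.
  by rewrite run_put arrs_seta; case: ifP.
by case: ifP => _; case: ifP => _ sj; rewrite ?/split_put ?/join_put; do ?apply: (put).
Qed.

(** [B + wt a] indexes [aDU]. Its bound does not follow from those on the summands, but from its
    being the mask of all activities of the bag. *)
Lemma sem_bound U y (X : {set player}) a k t B : y <= n -> sem U y X a k t B ->
  [/\ a < S, k < S, t < S, B < S & B + wt a < S].
Proof.
move=> yn [f v]; have [ap kn tn Bp] := valid_bound yn v.
have mS := players_lt_range; have pS := exp2_lt_range.
split; [exact: leq_ltn_trans acts_lt_range|exact: leq_ltn_trans mS
  |exact: leq_ltn_trans mS|exact: ltn_trans pS|].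
apply: ltn_trans pS; apply: lt_bit => b; rewrite (used_bits _ yn v).
by case/exists_inP => i iX /eqP fi; rewrite -fi; exact: valid_act v iX.
Qed.

Definition combine_vars := [:: va; vk; vt; vB; va'; vk'; vt'; vB'].

(** Written cells are justified by [glue_valid], and [split_valid] finds the two entries from which
    a given tuple arises. Both source blocks end before [r], so writing the target does not disturb
    them. *)
Lemma run_combine U (x : player) y (X Y : {set player}) r1 r2 r s :
    static s -> vars s vx = x -> vars s vy = y -> vars s vfr = r -> y <= n ->
    arrs s aRb x = r1 -> arrs s aRb y = r2 ->
    r1 + row_size <= r -> r2 + row_size <= r -> blank s r ->
    row_spec s r1 U x X -> row_spec s r2 U y Y ->
    [disjoint X & Y] ->
    (forall i j, i \in X -> j \in Y -> net i j -> i = x /\ j = y :> nat) ->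
    (forall j : player, j = y :> nat -> net x j) ->
    x \in X -> (forall j : player, j = y :> nat -> j \in Y) ->
  let s' := run Q vS (LFors combine_vars combine) s in
  [/\ forall j, j < r -> arrs s' aD j = arrs s aD j, blank s' (r + row_size) &
      row_spec s' r U y (X :|: Y)].
Proof.
move=> st sx sy sr yn s1 s2 le1 le2 bl R1 R2 dXY cross xy xX yY s'.
have xn : x <= n by apply: ltnW; exact: ltn_ord.
have S1 : 1 < S by have := players_lt_range; lia.
pose I s' := [/\ forall j, j < r -> arrs s' aD j = arrs s aD j, blank s' (r + row_size) &
  forall a k t B, a < S -> k < S -> t < S -> B < S ->
      arrs s' aD (r + slot a k t B) != 0 -> sem U y (X :|: Y) a k t B].
have put s3 e1 e2 e3 e4 : static s3 -> vars s3 vfr = r -> I s3 ->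
    sem U y (X :|: Y) (eval Q s3 e1) (eval Q s3 e2) (eval Q s3 e3) (eval Q s3 e4) ->
    I (run Q vS (LPut aD (eRow (Var vfr) e1 e2 e3 e4) (N 1)) s3).
  move=> st3 fr3 [I1 I2 I3] sm; have [aS kS tS BS _] := sem_bound yn sm.
  have sl := slot_lt aS kS tS BS.
  rewrite run_put (@eval_row G) // [eval Q s3 (Var _)]/= fr3; split.
  - by move=> j jr; rewrite arrs_seta I1 // eqxx; case: eqP => //=; lia.
  - by move=> j jr; rewrite arrs_seta I2 // eqxx; case: eqP => //=; lia.
  move=> a k t B aS' kS' tS' BS'; rewrite arrs_seta eqxx eqn_add2l /=.
  case: (slot a k t B =P _) => [e _|_]; last exact: I3.
  by have [-> -> -> ->] := slot_inj kS' tS' BS' kS tS BS e.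
have fE s3 : frame (LFors combine_vars combine) s s3 ->
    [/\ static s3, vars s3 vx = x, vars s3 vy = y, vars s3 vfr = r &
        arrs s3 aRb x = r1 /\ arrs s3 aRb y = r2].
  by move=> f; split; rewrite ?f.1 ?f.2 //; exact: static_frame f _ _ st.
have rowE s3 v e1 e2 e3 e4 : static s3 -> eval Q s3 e1 < S -> eval Q s3 e2 < S ->
    eval Q s3 e3 < S ->
    eval Q s3 (Get aD (eRow (Get aRb (Var v)) e1 e2 e3 e4)) =
    arrs s3 aD (arrs s3 aRb (vars s3 v) +
      slot (eval Q s3 e1) (eval Q s3 e2) (eval Q s3 e3) (eval Q s3 e4)).
  move=> st3 h1 h2 h3.
  by have <- := @eval_row G Q s3 (Get aRb (Var v)) e1 e2 e3 e4 st3 h1 h2 h3.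
have row1 s3 : frame (LFors combine_vars combine) s s3 -> I s3 ->
    vars s3 va < S -> vars s3 vk < S -> vars s3 vt < S -> vars s3 vB < S ->
    eval Q s3 (Get aD (eRow (Get aRb (Var vx)) (Var va) (Var vk) (Var vt) (Var vB))) != 0
    <-> sem U x X (vars s3 va) (vars s3 vk) (vars s3 vt) (vars s3 vB).
  move=> f [I1 _ _] aS kS tS BS; have [st3 x3 y3 fr3 [a1 a2]] := fE s3 f.
  rewrite rowE // x3 a1 I1; first exact: R1.
  by apply: leq_trans le1; rewrite ltn_add2l slot_lt.
have row2 s3 : frame (LFors combine_vars combine) s s3 -> I s3 ->
    vars s3 va' < S -> vars s3 vk' < S -> vars s3 vt' < S -> vars s3 vB' < S ->
    eval Q s3 (Get aD (eRow (Get aRb (Var vy)) (Var va') (Var vk') (Var vt') (Var vB'))) != 0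
    <-> sem U y Y (vars s3 va') (vars s3 vk') (vars s3 vt') (vars s3 vB').
  move=> f [I1 _ _] aS kS tS BS; have [st3 x3 y3 fr3 [a1 a2]] := fE s3 f.
  rewrite rowE // y3 a2 I1; first exact: R2.
  by apply: leq_trans le2; rewrite ltn_add2l slot_lt.
have I0 : I s.
  split=> // [j rj|a k t B _ _ _ _]; first by apply: bl; lia.
  by rewrite bl //; lia.
have IS s3 : frame (LFors combine_vars combine) s s3 -> in_range vS combine_vars s s3 ->
    I s3 -> I (run Q vS combine s3).
  rewrite /in_range /= (st_S st) => f /and5P[aS kS tS BS /and5P[aS' kS' tS' BS' _]] I3.
  have [st3 x3 y3 fr3 _] := fE s3 f.
  rewrite /combine run_guard; case: ifP => // /and3P[/(row1 _ f I3 aS kS tS BS) sm1].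
  move=> /(row2 _ f I3 aS' kS' tS' BS') sm2 _.
  have [_ _ _ _ Ba] := sem_bound xn sm1; have [_ _ _ _ Ba'] := sem_bound yn sm2.
  rewrite run_seq.
  have I4 : I (run Q vS (LGuard join_guard join_put) s3).
    rewrite run_guard; case: ifP => // /(join_guardP st3 BS BS')[aa a0 kk d].
    by apply: put => //; apply: (glue_valid yn dXY cross xy sm1 sm2); left.
  have f4 := run_frame Q vS (LGuard join_guard join_put) s3.
  set s4 := run _ _ _ s3 in I4 f4 *; clearbody s4.
  rewrite run_guard; case: ifP => // g.
  have st4 : static s4 by apply: static_frame f4 _ _ st3.
  have v4 z : vars s4 z = vars s3 z by apply: f4.1.
  have := split_guardP st4; rewrite !v4 => /(_ Ba Ba')[/(_ g)[tk d c1 c2] _].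
  apply: put => //; first by rewrite v4.
  rewrite /= (st_W st4) !v4; apply: (glue_valid yn dXY cross xy sm1 sm2); right.
  by rewrite x3 y3 in c1 c2; split.
have [I1 I2 I3] : I s' by apply: run_fors_inv.
split=> // a' k' t2 B2 aS' kS' tS2 BS2; split=> [|sm]; first exact: I3.
have [a [k [t [B [t' [B' [sm1 sm2 ok]]]]]]] := split_valid yn dXY cross xy xX yY sm.
have [aS kS tS BS Ba] := sem_bound xn sm1.
have [_ _ tS' BS' Ba'] := sem_bound yn sm2.
pose K s3 := arrs s3 aD (r + slot a' k' t2 B2) != 0.
apply: (@run_fors_hit Q vS combine_vars combine s [:: a; k; t; B; a'; k'; t'; B'] I K) => //.
- by rewrite /= (st_S st) aS kS tS BS aS' kS' tS' BS'.
- by move=> s3 _ _ _; apply: combine_mono.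
move=> s3 f I3' [aE kE tE BE aE' kE' tE' BE'].
have [st3 x3 y3 fr3 _] := fE s3 f.
rewrite /K /combine run_guard ifT; last first.
  apply/and3P; split=> //; [apply/row1 => //|apply/row2 => //];
  by rewrite ?aE ?kE ?tE ?BE ?aE' ?kE' ?tE' ?BE'.
rewrite run_seq; have := join_guardP st3; rewrite aE kE BE aE' kE' BE' => /(_ BS BS') jP.
have f4 := run_frame Q vS (LGuard join_guard join_put) s3.
case: ok => [[aa a0 kk tt [d BB]]|[tk d c1 c2 [tt BB]]].
  have K4 : K (run Q vS (LGuard join_guard join_put) s3).
    rewrite run_guard ifT; last exact/jP.
    rewrite /K run_put arrs_seta (@eval_row G) //=; rewrite ?tE ?tE' ?aE' ?kE' ?BE ?BE' ?tt //.
    by rewrite fr3 BB eqxx.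
  rewrite run_guard; case: ifP => // _.
  by rewrite run_put arrs_seta; case: ifP.
set s4 := run Q vS (LGuard join_guard join_put) s3 in f4 *; clearbody s4.
have st4 : static s4 by apply: static_frame f4 _ _ st3.
have v4 z : vars s4 z = vars s3 z by apply: f4.1.
rewrite run_guard ifT; last first.
  have := split_guardP st4; rewrite !v4 aE kE tE BE aE' kE' BE' x3 y3.
  by move=> /(_ Ba Ba') gP; apply/gP.
rewrite run_put arrs_seta (@eval_row G) //=; rewrite ?v4 ?tE' ?aE' ?kE' ?tt //.
by rewrite (st_W st4) ?v4 aE BE BE' fr3 BB eqxx.
Qed.

End Rows.

(** * Dismantling the forest *)

Section Elimination.

Variable G : gGASP.
Local Notation n := (nplayers G).
Local Notation player := 'I_(nplayers G).
Local Notation Q := (@pref_oracle G).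
Local Notation wt := (wt G).
Local Notation S := (range G).
Local Notation static := (static G).

Local Notation row_size := (S * (S * (S * S))).
Local Notation row_spec := (@row_spec G).

Lemma nth_allpairs_mul (T U V : Type) (x0 : V) (t0 : T) (u0 : U) (f : T -> U -> V) s t i j :
    i < size s -> j < size t ->
  nth x0 [seq f x y | x <- s, y <- t] (i * size t + j) = f (nth t0 s i) (nth u0 t j).
Proof.
elim: s i => // x s IH [|i] /= si tj; rewrite nth_cat size_map.
  by rewrite tj (nth_map u0).
by rewrite ltnNge mulSn -addnA leq_addr /= addKn IH.
Qed.

Lemma input_net s (x j : player) : static s ->
  (arrs s 0 (arrs s aR x + j) != 0) = net x j.
Proof.
move=> st; have xS : x < S by have := ltn_ord x; rewrite /range; lia.
rewrite (st_R st) // (st_in st) -addnA /= /encode_gGASP.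
have /= := @nth_allpairs_mul _ _ nat 0 x x (fun i j => net i j : nat)
  (enum 'I_n) (enum 'I_n) x j.
rewrite size_enum_ord => -> //; rewrite !nth_ord_enum.
by case: (net x j).
Qed.

Definition alive (s : store) : {set player} := [set v : player | arrs s aAl v != 0].

(** A counter [j >= n] would read beyond the row of [x] in the matrix; the hypothesis on [aAl]
    prevents it. The invariant tells apart no, one, and at least two neighbours met so far. *)
Lemma run_neighbours (x : player) s :
    static s -> vars s vx = x ->
    (forall j, j < S -> arrs s aAl j != 0 -> j < n) ->
  let s' := run Q vS neighbours s in
  (vars s' vcnt < 2 ->
    [/\ vars s' vy <= n,
        forall w, w \in alive s -> net x w -> w = vars s' vy :> nat &
        forall w : player, w = vars s' vy :> nat -> w \in alive s /\ net x w]) /\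
  ((forall i j, i \in alive s -> j \in alive s -> net x i -> net x j -> i = j) ->
    vars s' vcnt < 2).
Proof.
move=> st sx al s'.
pose nb j := [exists w : player, [&& w == j :> nat, w \in alive s & net x w]].
have nbP (w : player) : nb w = (w \in alive s) && net x w.
  apply/existsP/idP => [[v /andP[/eqP/val_inj->]]//|h].
  by exists w; rewrite eqxx.
pose I i s' := [\/ [/\ vars s' vcnt = 0, vars s' vy = n & forall j, j < i -> ~~ nb j],
  [/\ vars s' vcnt = 1, nb (vars s' vy), vars s' vy < i &
      forall j, j < i -> nb j -> j = vars s' vy] |
  2 <= vars s' vcnt /\ exists u v : nat, [/\ nb u, nb v & u <> v]].
have : I S s'.
  rewrite /s' /neighbours !run_seq !run_assign; set s1 := setv _ _ _.
  have st1 : static s1 by do !apply: static_setv => //.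
  set c := LFor _ _; rewrite -(st_S st1).
  apply: (@run_for_ind Q vS vj _ s1 I); last by [].
    by constructor 1; split=> //=; rewrite (st_n st).
  move=> j s2 jS f I2; rewrite (st_S st1) in jS.
  set s3 := setv s2 vj j.
  have st3 : static s3 by apply: static_setv => //; apply: static_frame f _ _ st1.
  have gE : all (fun e => eval Q s3 e != 0)
      [:: Get aAl (Var vj); Get 0 (Add (Get aR (Var vx)) (Var vj))] = nb j.
    have x3 : vars s3 vx = x by rewrite /s3 /= f.1.
    have A3 : arrs s3 aAl = arrs s aAl by rewrite /s3 /= f.2.
    have j3 : vars s3 vj = j by [].
    clearbody s3; rewrite /= x3 j3 A3 andbT.
    apply/andP/existsP => [[Aj xj]|[w /and3P[/eqP<- + xw]]]; last first.
      by rewrite inE => ->; rewrite input_net.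
    have jn := al _ jS Aj; exists (Ordinal jn); rewrite eqxx inE Aj /=.
    by rewrite -(input_net _ _ st3).
  have j3 : vars s3 vj = j by [].
  have c3 : vars s3 vcnt = vars s2 vcnt by [].
  have y3 : vars s3 vy = vars s2 vy by [].
  clearbody s3; rewrite run_guard gE; case: ifP => nbj; last first.
    rewrite /I c3 y3; case: I2 => [[c0 yn no]|[c1 yb yj u]|[c2 two]].
    - constructor 1; split=> // k; rewrite ltnS leq_eqVlt => /predU1P[->|/no//].
      by rewrite nbj.
    - constructor 2; split=> //; first exact: ltnW.
      by move=> k; rewrite ltnS leq_eqVlt => /predU1P[->|/u//]; rewrite nbj.
    by constructor 3.
  rewrite run_seq !run_assign /I /= c3 j3; case: I2 => [[-> yn no]|[-> yb yj u]|[c2 two]].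
  - constructor 2; split=> // k; rewrite ltnS leq_eqVlt => /predU1P[->|/no/negPf->] //.
  - constructor 3; split=> //; exists j, (vars s2 vy); split=> // e.
    by rewrite e ltnn in yj.
  by constructor 3; split=> //; lia.
have lS (w : player) : w < S by have := ltn_ord w; rewrite /range; lia.
case=> [[c0 yn no]|[c1 yb yS u]|[c2 [u [v [ub vb uv]]]]].
- rewrite c0 yn; split=> // _; split=> // w.
    by move=> wA xw; have := no w (lS w); rewrite nbP wA xw.
  by move=> wn; have := ltn_ord w; rewrite wn ltnn.
- rewrite c1; split=> // _; have /existsP[w0 /and3P[/eqP w0y w0A xw0]] := yb.
  split; first by rewrite -w0y; apply: ltnW; apply: ltn_ord.
    by move=> w wA xw; apply: u (lS w) _; rewrite nbP wA.
  by move=> w wy; have := yb; rewrite -wy nbP => /andP.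
split; first by rewrite ltnNge c2.
move=> H; case: uv.
have /existsP[u' /and3P[/eqP<- u'A xu]] := ub.
have /existsP[v' /and3P[/eqP<- v'A xv]] := vb.
by rewrite (H u' v').
Qed.

Definition node (s : store) (v : nat) : bool :=
  (v == n) || [exists w : player, (w == v :> nat) && (w \in alive s)].

Lemma node_alive s (w : player) : node s w = (w \in alive s).
Proof.
rewrite /node ltn_eqF //=; apply/existsP/idP => [[v /andP[/eqP/val_inj->]]//|wA].
by exists w; rewrite eqxx.
Qed.

(** The bags exist only in the proof. An edge between two bags joins the very vertices that name
    them; in particular no edge leaves the bag of [n]. *)
Definition elim_spec (U : nat) (s : store) : Prop :=
  [/\ blank s (vars s vfr),
      forall j, j < S -> arrs s aAl j != 0 -> j < n &
      exists bag : nat -> {set player},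
      [/\ forall v, node s v -> arrs s aRb v + row_size <= vars s vfr /\
            row_spec s (arrs s aRb v) U v (bag v),
          forall u v, node s u -> node s v -> u <> v -> [disjoint bag u & bag v],
          forall u v i j, node s u -> node s v -> u <> v -> i \in bag u ->
            j \in bag v -> net i j -> i = u :> nat /\ j = v :> nat,
          forall i, exists2 u, node s u & i \in bag u &
          forall w : player, w \in alive s -> w \in bag w]].

Lemma run_merge_rows U s (x : player) y :
    static s -> elim_spec U s -> vars s vx = x -> vars s vy = y ->
    x \in alive s -> y <= n ->
    (forall w, w \in alive s -> net x w -> w = y :> nat) ->
    (forall w : player, w = y :> nat -> w \in alive s /\ net x w) ->
  let s' := run Q vS merge_rows s in elim_spec U s' /\ alive s' = alive s :\ x.
Proof.
move=> st [bl al [bag [rowP disj cross cover self_bag]]] sx sy xA yn nb1 nb2 s'.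
have xy : x <> y :> nat by move=> /nb2[_]; rewrite net_irr.
have nodex : node s x by rewrite node_alive.
have nodey : node s y.
  rewrite /node; have [//|yn'] := eqVneq y n; have yltn : y < n by rewrite ltn_neqAle yn'.
  apply/existsP; exists (Ordinal yltn); rewrite eqxx /=.
  by have [] := nb2 (Ordinal yltn) erefl.
rewrite {}/s' /merge_rows !run_seq.
have -> : run Q vS (LPut aAl (Var vx) (N 0)) s = seta s aAl x 0.
  by rewrite run_put /= sx.
set s1 := seta _ _ _ _.
have st1 : static s1 by case: st => *; split.
have s1D : arrs s1 aD = arrs s aD by [].
have s1R : arrs s1 aRb = arrs s aRb by [].
have s1fr : vars s1 vfr = vars s vfr by [].
have [rx1 rx2] := rowP x nodex; have [ry1 ry2] := rowP y nodey.
have rs v : row_spec s (arrs s aRb v) U v (bag v) -> row_spec s1 (arrs s aRb v) U v (bag v).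
  by apply: row_spec_ext => j _; rewrite s1D.
have A1 j : arrs s1 aAl j = if j == x :> nat then 0 else arrs s aAl j.
  by rewrite /s1 arrs_seta eqxx.
have v1x : vars s1 vx = x by rewrite /s1.
have v1y : vars s1 vy = y by rewrite /s1.
clearbody s1.
have [||||||||||||D1 D2 D3] := @run_combine G U x y (bag x) (bag y) (arrs s aRb x) (arrs s aRb y)
  (vars s vfr) s1 st1 v1x v1y s1fr yn; rewrite ?s1R //.
- by move=> j; rewrite s1D; exact: bl.
- exact: rs.
- exact: rs.
- exact: disj.
- by move=> i j ix jy ij; have [/val_inj-> ->] := cross x y i j nodex nodey xy ix jy ij.
- by move=> w /nb2[].
- exact: self_bag.
- by move=> w wy; rewrite -wy; apply: self_bag; have [] := nb2 w wy.
set c := LFors _ _; have f2 := run_frame Q vS c s1.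
set s2 := run Q vS c s1 in D1 D2 D3 f2 *.
have v2y : vars s2 vy = y by rewrite f2.1.
have v2fr : vars s2 vfr = vars s vfr by rewrite f2.1.
have A2 j : arrs s2 aAl j = if j == x :> nat then 0 else arrs s aAl j by rewrite f2.2.
have st2 : static s2 by apply: static_frame f2 _ _ st1.
have R2 : arrs s2 aRb = arrs s aRb by rewrite f2.2.
clearbody s2; rewrite run_assign.
have -> : run Q vS (LPut aRb (Var vy) (Var vfr)) s2 = seta s2 aRb y (vars s vfr).
  by rewrite run_put /= v2y v2fr.
set s3 := setv _ _ _.
have fr3 : vars s3 vfr = vars s vfr + row_size by rewrite /s3 /= v2fr (st_S4 st2).
have A3 j : arrs s3 aAl j = if j == x :> nat then 0 else arrs s aAl j by rewrite /s3 /= A2.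
have D3' : arrs s3 aD = arrs s2 aD by [].
have R3 v : arrs s3 aRb v = if v == y then vars s vfr else arrs s aRb v.
  by rewrite /s3 arrs_setv arrs_seta eqxx R2.
clearbody s3.
have alE : alive s3 = alive s :\ x.
  by apply/setP => w; rewrite !inE A3 (inj_eq val_inj); case: (w == x).
have nodeE v : node s3 v = node s v && (v != x).
  rewrite /node; have [->|vn] := eqVneq v n; first by rewrite gtn_eqF.
  rewrite /= alE; apply/existsP/andP => [[w /andP[/eqP<-]]|[/existsP[w /andP[/eqP<- wA]] wx]].
    rewrite !inE => /andP[wx wA]; split; last by rewrite (inj_eq val_inj).
    by apply/existsP; exists w; rewrite eqxx inE.
  by exists w; rewrite eqxx in_setD1 wA andbT -(inj_eq val_inj).
split=> //; split.
- by rewrite fr3 => j; rewrite D3'; exact: D2.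
- by move=> j jS; rewrite A3; case: ifP => // _; exact: al.
exists (fun v => if v == y then bag x :|: bag y else bag v); split.
- move=> v; rewrite nodeE R3 fr3 => /andP[nv _]; case: eqP => [->|_].
    by split=> // a k t B aS kS tS BS; rewrite D3'; exact: D3.
  have [rv1 rv2] := rowP v nv; split; first by rewrite (leq_trans rv1) ?leq_addr.
  apply: row_spec_ext rv2 => j jr; rewrite D3' D1 ?s1D //.
  exact: leq_trans jr rv1.
- move=> u v; rewrite !nodeE => /andP[nu /eqP ux] /andP[nv /eqP vx] uv.
  case: eqP => [uy|_]; case: eqP => [vy|_]; rewrite ?uy ?vy in uv *.
  + by [].
  + by rewrite -setI_eq0 setIUl setU_eq0 !setI_eq0 !disj //; apply/nesym.
  + by rewrite -setI_eq0 setIUr setU_eq0 !setI_eq0 !disj.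
  + exact: disj.
- move=> u v i j; rewrite !nodeE => /andP[nu /eqP ux] /andP[nv /eqP vx] uv.
  (* An edge from the bag of [x] to a third bag would make some remaining vertex other than [y] a
     neighbour of [x]. *)
  have bad w k : node s w -> w <> x -> w <> y -> k \in bag w -> forall l, l \in bag x ->
      net l k -> False.
    move=> nw wx wy kw l lx lk.
    have [lE kE] := cross x w l k nodex nw (nesym wx) lx kw lk.
    have kA : k \in alive s by rewrite -node_alive kE.
    by apply: wy; rewrite -kE; apply: nb1 => //; rewrite -(val_inj lE).
  case: eqP => [uy|uy]; case: eqP => [vy|vy]; rewrite ?uy ?vy in uv *.
  + by [].
  + case/setUP=> [ix|iy] jv ij; first by case: (bad v j nv vx vy jv i ix ij).
    exact: cross nodey nv uv iy jv ij.
  + move=> iu /setUP[jx|jy] ij; last exact: cross nu nodey uv iu jy ij.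
    by rewrite net_sym in ij; case: (bad u i nu ux uy iu j jx ij).
  + exact: cross.
- move=> i; have [u nu iu] := cover i; have [ux|ux] := eqVneq u x.
    exists y; first by rewrite nodeE nodey; apply/eqP/nesym.
    by rewrite eqxx inE -ux iu.
  exists u; first by rewrite nodeE nu.
  by case: eqP => // uy; rewrite inE -uy iu orbT.
move=> w; rewrite alE !inE => /andP[wx wA]; have wb := self_bag w.
by case: eqP => [wy|_]; rewrite ?inE -?wy wb ?orbT // inE.
Qed.

Lemma run_visit U s (s' := run Q vS visit s) :
    static s -> elim_spec U s -> vars s vx < S ->
  [/\ elim_spec U s', alive s' \subset alive s &
    forall x : player, x = vars s vx :> nat ->
      (forall i j, i \in alive s -> j \in alive s -> net x i -> net x j -> i = j) ->
      x \notin alive s'].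
Proof.
move=> st es xS; rewrite {}/s' /visit run_guard [all _ _]/= andbT.
have [Ax|Ax] := boolP (_ != 0); last first.
  by split=> // x xE _; rewrite inE xE.
have [_ al _] := es; have xn := al _ xS Ax; pose x := Ordinal xn.
have xE : vars s vx = x by [].
have xA : x \in alive s by rewrite inE.
rewrite run_seq; have [N1 N2] := run_neighbours st xE al.
have f1 := run_frame Q vS neighbours s.
set s1 := run Q vS neighbours s in N1 N2 f1 *.
have es1 : elim_spec U s1.
  have fr1 : vars s1 vfr = vars s vfr by rewrite f1.1.
  have a1 : arrs s1 aD = arrs s aD by rewrite f1.2.
  have a2 : arrs s1 aRb = arrs s aRb by rewrite f1.2.
  have a3 : arrs s1 aAl = arrs s aAl by rewrite f1.2.
  have nE v : node s1 v = node s v by rewrite /node /alive a3.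
  have alE : alive s1 = alive s by rewrite /alive a3.
  have [bl _ [bag [B1 B2 B3 B4 B5]]] := es; split.
  - by move=> j; rewrite fr1 a1; exact: bl.
  - by rewrite a3.
  exists bag; split.
  - move=> v; rewrite nE a2 fr1 => /B1[h1 h2]; split=> //.
    by apply: row_spec_ext h2 => j _; rewrite a1.
  - by move=> u v; rewrite !nE; exact: B2.
  - by move=> u v i j; rewrite !nE; exact: B3.
  - by move=> i; have [u nu iu] := B4 i; exists u; rewrite ?nE.
  by rewrite alE.
have alE : alive s1 = alive s by rewrite /alive f1.2.
have st1 : static s1 by apply: static_frame f1 _ _ st.
have x1 : vars s1 vx = x by rewrite f1.1.
clearbody s1; rewrite run_guard [all _ _]/= andbT.
have -> : (2 - vars s1 vcnt != 0) = (vars s1 vcnt < 2) by rewrite subn_eq0 -ltnNge.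
case: ifP => cnt; last first.
  split; rewrite ?alE // => x' x'E H; move: cnt; rewrite N2 // => i j iA jA xi xj.
  have x'x : x' = x by apply: val_inj; rewrite /= x'E.
  by apply: H; rewrite ?x'x.
have [yn nb1 nb2] := N1 cnt.
have [|||es2 alE2] := run_merge_rows st1 es1 x1 erefl _ yn; rewrite ?alE //.
split=> //; rewrite alE2 alE; first exact: subsetDl.
move=> x' x'E _; have -> : x' = x by apply: val_inj; rewrite /= x'E.
by rewrite !inE eqxx.
Qed.

(** Each round removes a vertex: some vertex is a leaf when the round starts, and since vertices
    only disappear, it still has at most one remaining neighbour when its turn comes. Hence n rounds
    already suffice. *)
Lemma run_elimination U s (s' := run Q vS elimination s) :
    acyclic G -> static s -> elim_spec U s ->
  elim_spec U s' /\ alive s' = set0.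
Proof.
move=> acG st es.
pose I i s' := elim_spec U s' /\ #|alive s'| <= n - i.
have : I S s'.
  rewrite /s' -(st_S st); apply: run_for_ind => //.
    by split=> //; rewrite subn0 -[X in _ <= X]card_ord max_card.
  move=> i s1 iS f [es1 c1]; rewrite /LFors.
  set s2 := setv s1 vr i.
  have st2 : static s2 by apply: static_setv => //; apply: static_frame f _ _ st.
  have es2 : elim_spec U s2 by [].
  have al2 : alive s2 = alive s1 by [].
  clearbody s2; rewrite -/(LFors [:: vx] visit).
  pose J s' := elim_spec U s' /\ alive s' \subset alive s2.
  have stf z : frame (LFors [:: vx] visit) s2 z -> static z.
    by move=> f'; apply: static_frame f' _ _ st2.
  have JS s3 : frame (LFors [:: vx] visit) s2 s3 -> in_range vS [:: vx] s2 s3 ->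
      J s3 -> J (run Q vS visit s3).
    move=> f' /andP[x3 _] [es3 al3]; rewrite (st_S st2) in x3.
    have [es4 al4 _] := run_visit (stf _ f') es3 x3; split=> //.
    exact: subset_trans al4 al3.
  have J2 : J s2 by [].
  have Jx z x v : x \in [:: vx] -> J z -> J (setv z x v) by rewrite inE => /eqP->.
  have [es4 al4] : J (run Q vS (LFors [:: vx] visit) s2) by apply: run_fors_inv.
  split=> //; set s4 := run _ _ _ s2 in es4 al4 *.
  have [a0|a0] := eqVneq (alive s2) set0.
    by move: al4; rewrite a0 subset0 => /eqP->; rewrite cards0.
  have [x xA leaf] := acyclic_leaf acG a0.
  have xN : x \notin alive s4.
    apply: (@run_fors_hit Q vS [:: vx] visit s2 [:: x : nat] J
      (fun s' => x \notin alive s')) => //.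
    - by rewrite /= (st_S st2) andbT; have := ltn_ord x; rewrite /range; lia.
    - move=> s3 f' /andP[x3 _] [es3 al3] xN; rewrite (st_S st2) in x3.
      have [_ al5 _] := run_visit (stf _ f') es3 x3.
      by apply: contra xN => /(subsetP al5).
    move=> s3 f' [es3 al3] [xE].
    have x3 : vars s3 vx < S by rewrite xE; have := ltn_ord x; rewrite /range; lia.
    have [_ _] := run_visit (stf _ f') es3 x3; apply; first by rewrite xE.
    move=> u v uA vA; apply: leaf; exact: (subsetP al3).
  suff : #|alive s4| < #|alive s2| by rewrite al2; lia.
  by apply/proper_card/properP; split=> //; exists x.
case=> es' c; split=> //; apply/eqP; rewrite -cards_eq0 -leqn0.
by apply: leq_trans c _; rewrite /range; lia.
Qed.

(** In the end only the virtual player is left, and since the bags cover all players, its bag is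
    everything. The free pointer is not reset, so the next attempt again starts on blank cells. *)
Lemma run_attempt U s (s' := run Q vS attempt s) :
    acyclic G -> static s -> vars s vU = U -> U < S -> blank s (vars s vfr) ->
  blank s' (vars s' vfr) /\
  (sem U n [set: player] 0 1 1 U /\ vars s' 0 = 1 \/
   ~ sem U n [set: player] 0 1 1 U /\ vars s' 0 = vars s 0).
Proof.
move=> acG st sU US bl; rewrite {}/s' /attempt run_seq.
have S1 : 1 < S by have := players_lt_range G; lia.
have nS : n < S by rewrite /range; lia.
have pS (w : player) : w < S by apply: ltn_trans (ltn_ord w) nS.
have [bl1 ini] := run_initial st sU US bl.
have f1 := run_frame Q vS initial s.
set s1 := run Q vS initial s in bl1 ini f1 *.
have st1 : static s1 by apply: static_frame f1 _ _ st.
have s1U : vars s1 vU = U by rewrite f1.1.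
have s10 : vars s1 0 = vars s 0 by rewrite f1.1.
clearbody s1.
have alE : alive s1 = setT.
  by apply/setP => w; rewrite !inE; have [_ _ ->] := ini w (pS w); exact: ltn_ord.
have nodeE v : node s1 v -> v <= n /\ v < S.
  by case/orP => [/eqP->|/existsP[w /andP[/eqP<- _]]]; split=> //; apply: ltnW; exact: ltn_ord.
have es1 : elim_spec U s1.
  split=> //; first by move=> j jS; have [_ _ ->] := ini j jS.
  exists (@self G); split.
  - by move=> v /nodeE[vn vS]; have [h1 h2 _] := ini v vS; split=> //; apply: h2.
  - move=> u v _ _ uv; rewrite -setI_eq0; apply/eqP/setP => i; rewrite !inE.
    by apply/negP => /andP[/eqP iu /eqP iv]; apply: uv; rewrite -iu -iv.
  - by move=> u v i j _ _ _; rewrite !inE => /eqP-> /eqP->.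
  - by move=> i; exists (i : nat); [rewrite node_alive alE inE | rewrite inE].
  by move=> w _; rewrite inE.
rewrite run_seq; have [es2 al2] := run_elimination acG st1 es1.
have f2 := run_frame Q vS elimination s1.
set s2 := run Q vS elimination s1 in es2 al2 f2 *.
have st2 : static s2 by apply: static_frame f2 _ _ st1.
have s2U : vars s2 vU = U by rewrite f2.1.
have s20 : vars s2 0 = vars s 0 by rewrite f2.1.
clearbody s2.
have [bl2 _ [bag [B1 _ _ B4 _]]] := es2.
have nE v : node s2 v -> v = n.
  by case/orP => [/eqP//|/existsP[w]]; rewrite al2 inE andbF.
have bagT : bag n = setT.
  by apply/setP => i; rewrite inE; have [u /nE-> ->] := B4 i.
have [|_ row] := B1 n; first by rewrite /node eqxx.
rewrite bagT in row.
rewrite run_guard; set b := all _ _.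
have bE : b <-> sem U n [set: player] 0 1 1 U.
  rewrite -row ?(ltnW S1) // /b /= (st_n st2) (st_T1 st2) // (st_T2 st2) //.
  by rewrite (st_T3 st2) ?(ltnW S1) // s2U andbT.
case: ifP => bT; last by split=> //; right; split=> // /bE; rewrite bT.
by split=> //; left; split=> //; apply/bE.
Qed.

Lemma run_solve s (s' := run Q vS solve s) :
    acyclic G -> vars s vS = S -> vars s vn = n -> vars s 0 = 0 ->
    (forall j, arrs s 0 j = nth 0 (encode_gGASP G) j) ->
    (forall b, arrs s aW b = wt b) -> (forall j, arrs s aDU j = 0) ->
    (forall j, arrs s aD j = 0) ->
  vars s' 0 = has_Nash_stable G.
Proof.
move=> acG sS sn s0 sin sW sDU sD; rewrite {}/s' /solve run_seq.
have st := run_preparation Q sS sn sin sW sDU.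
have f := run_frame Q vS preparation s.
set s1 := run Q vS preparation s in st f *.
have s10 : vars s1 0 = 0 by rewrite f.1.
have bl : blank s1 (vars s1 vfr) by move=> j _; rewrite f.2.
clearbody s1.
pose I s' := blank s' (vars s' vfr) /\ (vars s' 0 = 0 \/ vars s' 0 = 1 /\ has_Nash_stable G).
have semN U : sem U n [set: player] 0 1 1 U -> has_Nash_stable G.
  by move=> sm; apply/has_Nash_stableP; exists U.
have stf s' : frame (LFors [:: vU] attempt) s1 s' -> static s'.
  by move=> f'; apply: static_frame f' _ _ st.
have IS s2 : frame (LFors [:: vU] attempt) s1 s2 -> in_range vS [:: vU] s1 s2 ->
    I s2 -> I (run Q vS attempt s2).
  move=> f2 /andP[U2 _] [bl2 ans]; rewrite (st_S st) in U2.
  have [bl3 [[sm v0]|[_ v0]]] := run_attempt acG (stf _ f2) erefl U2 bl2.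
    by split=> //; right; split=> //; exact: semN sm.
  by split=> //; rewrite v0.
have Is1 : I s1 by split=> //; left.
have Ix z x v : x \in [:: vU] -> I z -> I (setv z x v) by rewrite inE => /eqP->.
have [_ [ans|[-> ->]//]] : I (run Q vS (LFors [:: vU] attempt) s1).
  by apply: run_fors_inv.
case hN: (has_Nash_stable G); last by [].
have /has_Nash_stableP[U sm] := hN.
(* [U] is itself the mask of the root tuple, hence below S, and the loop meets it. *)
have [_ _ _ US _] := sem_bound (leqnn n) sm.
suff : vars (run Q vS (LFors [:: vU] attempt) s1) 0 <> 0 by [].
apply: (@run_fors_hit Q vS [:: vU] attempt s1 [:: U] I (fun s' => vars s' 0 <> 0)) => //.
- by rewrite /= (st_S st) US.
- by move=> s' x v; rewrite inE => /eqP->.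
- move=> s2 f2 /andP[U2 _] [bl2 _] n0; rewrite (st_S st) in U2.
  by have [_ [[_ e]|[_ e]]] := run_attempt acG (stf _ f2) erefl U2 bl2; move=> h; rewrite e in h.
move=> s2 f2 [bl2 _] [UE].
by have [_ [[_ e] h|[]]] := run_attempt acG (stf _ f2) UE US bl2; first by rewrite e in h.
Qed.

End Elimination.

(** * Running time *)

(** This loop is bounded by p, because S is not known before 2^p has been computed by doubling. *)
Definition weights : lcmd :=
  LFor vx (LSeq (LPut aW (Add (Var vx) (N 1)) (Var vm))
                (LAssign vm (Add (Var vm) (Var vm)))).

Lemma run_weights (G : gGASP) o s (s' := run o vp weights s) :
    vars s vp = nacts G -> vars s vm = 1 -> (forall b, arrs s aW b = 0) ->
  (forall b, arrs s' aW b = wt G b) /\ vars s' vm = 2 ^ nacts G.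
Proof.
move=> sp sm sW.
pose I i s' := (forall b, arrs s' aW b = if 0 < b <= i then 2 ^ b.-1 else 0) /\
  vars s' vm = 2 ^ i.
suff : I (nacts G) s' by [].
rewrite /s' -sp; apply: (run_for_ind (I := I)) => //.
  by split=> // b; rewrite sW; case: b.
move=> i s1 _ _ [I1 I2]; rewrite !run_simp.
split; last by rewrite /= I2 addnn -mul2n expnS.
move=> b; rewrite arrs_setv arrs_seta /= I1 I2 addn1.
have [->|bi] := eqVneq b i.+1; first by rewrite leqnn.
by rewrite [b <= i.+1]leq_eqVlt (negPf bi).
Qed.

Definition algorithm : cmd :=
  Seq (Assign vp (Get 0 (N 1)))
  (Seq (Assign vm (N 1))
  (Seq (compile vp weights)
  (Seq (Assign vn (Get 0 (N 0)))
  (Seq (Assign vS (Add (Add (Var vm) (Var vn)) (N 1)))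
       (compile vS solve))))).

Lemma algorithm_correct (G : gGASP) : acyclic G ->
  exists2 t, halts_with (@pref_oracle G) algorithm (encode_gGASP G) t (has_Nash_stable G) &
    t <= 14 + costb (nacts G) weights + costb (range G) solve.
Proof.
move=> acG; set o := @pref_oracle G; pose s0 := init (encode_gGASP G).
pose s2 := setv (setv s0 vp (nacts G)) vm 1.
have [t3 e3 le3] := @compileP o vp weights s2 isT isT.
have [//|//|//|W3 m3] := @run_weights G o s2.
have f3 := run_frame o vp weights s2.
set s3 := run o vp weights s2 in e3 W3 m3 f3 *; clearbody s3.
pose s5 := setv (setv s3 vn (nplayers G)) vS (range G).
have n3 : arrs s3 0 0 = nplayers G by rewrite f3.2.
have [t6 e6 le6] := @compileP o vS solve s5 isT isT.
have ans : vars (run o vS solve s5) 0 = has_Nash_stable G.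
  apply: run_solve => //.
  - by rewrite /= f3.1.
  - by move=> j; rewrite !arrs_setv f3.2.
  - by move=> j; rewrite !arrs_setv f3.2.
  by move=> j; rewrite !arrs_setv f3.2.
(* The four assignments cost 3, 2, 3 and 6, which gives the constant 14. *)
exists (3 + (2 + (t3 + (3 + (6 + t6))))); last first.
  move: le3 le6; rewrite [vars s2 _]/= [vars s5 _]/=; lia.
exists (run o vS solve s5) => //; apply: ExecSeq (ExecAssign _ _ _ _) _.
apply: ExecSeq (ExecAssign _ _ _ _) _; apply: ExecSeq e3 _.
apply: ExecSeq (ExecAssign _ _ _ _) _; apply: ExecSeq (ExecAssign _ _ _ _) _.
rewrite -/o /= n3 m3 -/(range G); exact: e6.
Qed.

(** A factor 2^d without multiplication. [FPT] demands a program for f, and k repetitions of these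
    doublings compute (2^d)^k. *)
Definition doublings (d : nat) : lcmd :=
  iter d (fun c => LSeq c (LAssign 0 (Add (Var 0) (Var 0)))) LSkip.

Lemma doublings_avars d z : z != 0 -> z \notin avars (doublings d).
Proof.
by move=> z0; elim: d => //= d IH; rewrite mem_cat negb_or IH inE.
Qed.

Lemma doublings_ok d : loops_ok (doublings d).
Proof. by elim: d => //= d ->. Qed.

Lemma run_doublings o b d s : vars (run o b (doublings d) s) 0 = 2 ^ d * vars s 0.
Proof.
elim: d => [|d IH]; first by rewrite mul1n.
by rewrite /doublings iterS run_seq run_assign /= IH expnS; lia.
Qed.

Lemma computable_exp d : computable (fun k => (2 ^ d) ^ k).
Proof.
exists (Seq (Assign 1 (Get 0 (N 0)))
  (Seq (Assign 0 (N 1)) (compile 1 (LFor 2 (doublings d))))) => k.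
pose o : oracle := fun _ _ _ _ _ => false.
pose s := setv (setv (init [:: k]) 1 k) 0 1.
have [||t e _] := @compileP o 1 (LFor 2 (doublings d)) s.
- by rewrite /= doublings_avars ?doublings_ok.
- by rewrite /= inE negb_or doublings_avars.
exists (3 + (2 + t)); exists (run o 1 (LFor 2 (doublings d)) s).
  apply: ExecSeq (ExecAssign _ _ _ _) _; apply: ExecSeq (ExecAssign _ _ _ _) _.
  exact: e.
pose I i s' := vars s' 0 = (2 ^ d) ^ i.
apply: (@run_for_ind o 1 2 (doublings d) s I) => // i s' _ _ I'.
by rewrite /I run_doublings /= I' expnS.
Qed.

Theorem theorem16 :
  FPT acyclic encode_gGASP pref_oracle nacts has_Nash_stable.
Proof.
have [K [d costP]] := costb_poly solve.
(* The cost is at most 14 + (6 + 20 p) + K S^d. As p < S, the part without K is at most 40 S, whence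
   the constant 40 and the exponent [d.+1]. *)
pose q : {poly nat} := ((K + 40)%N *: 'X^(d.+1))%R.
exists algorithm, (fun k => (2 ^ d.+1) ^ k), q.
split=> [|G acG]; first exact: computable_exp.
have [t ht tle] := algorithm_correct acG; exists t => //.
have -> : q.[size (encode_gGASP G)]%R = (K + 40) * size (encode_gGASP G) ^ d.+1.
  by rewrite hornerZ hornerXn; congr (_ * _).
have sz : size (encode_gGASP G) = (nplayers G * nplayers G).+2.
  by rewrite /= size_allpairs size_enum_ord.
have S0 : 0 < range G by rewrite /range; lia.
(* Bounding the sum S by a product splits each power of S into a factor in p and one in the input
   size. *)
have le1 : range G <= 2 ^ nacts G * size (encode_gGASP G).
  have p0 : 0 < 2 ^ nacts G by rewrite expn_gt0.
  by rewrite sz /range; nia.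
have pS := acts_lt_range G.
have le2 : costb (nacts G) weights <= 6 + nacts G * 20 by rewrite /=; lia.
have le3 := costP _ S0.
have Sd : 0 < range G ^ d by rewrite expn_gt0 S0.
have -> : (2 ^ d.+1) ^ nacts G * ((K + 40) * size (encode_gGASP G) ^ d.+1) =
    (K + 40) * (2 ^ nacts G * size (encode_gGASP G)) ^ d.+1.
  by rewrite expnMn mulnCA -!expnM [d.+1 * _]mulnC.
apply: (@leq_trans ((K + 40) * range G ^ d.+1)); last by rewrite leq_mul2l leq_exp2r ?le1 ?orbT.
apply: leq_trans tle _; rewrite expnS.
by move: (range G ^ d) Sd le3 => R R0 le3; nia.
Qed.
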